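(* Let $n\ge 1$ and let $(F_1\times[0,1],L_1)$ and $(F_2\times[0,1],L_2)$ be elements of $V_n$ that are virtually equivalent. Then $h(F_1)-L_1$ and $h(F_2)-L_2$ are homotopy equivalent. That is, the homotopy type of $h(F)-L$ is invariant under virtual equivalence.
   Context: All manifolds and embeddings are smooth. $V_n$ is the set of pairs $(F\times[0,1],L)$ where $F$ is a compact $(n+1)$-manifold (possibly with boundary), $F\times[0,1]$ is regarded as the trivial $[0,1]$-bundle over $F$ with projection $\pi:F\times[0,1]\to F$, and $L$ is an $n$-manifold embedded in the interior of $F\times[0,1]$ that meets every component of $F\times[0,1]$. Write $(F_1\times[0,1],L_1)\sim(F_2\times[0,1],L_2)$ if there is an embedding $f:F_1\to F_2$ with $(f\times \mathrm{id}_{[0,1]})(L_1)=L_2$. Virtual equivalence $\cong$ is the equivalence relation on $V_n$ generated by $\sim$ together with smooth isotopy of the link $L$ in $F\times[0,1]$. For $(F\times[0,1],L)\in V_n$, $h(F)$ denotes the quotient space of $F\times[0,1]$ obtained by identifying $(x,1)$ with $(x',1)$ for all $x,x'\in F$ (collapsing $F\times\{1\}$ to one point); $L$ is regarded as a subset of $h(F)$.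
   Formalization: The link L is taken to be a closed n-manifold (compact, without boundary); for non-compact L, such as infinitely many small circles whose limit point is split in two by an isotopy through embeddings, the claim fails. *)

(* Defs.v *)
From HB Require Import structures.
From Stdlib Require Export Relations.Relation_Operators.
From mathcomp Require Export all_boot all_order all_algebra generic_quotient.
From mathcomp Require Export all_classical all_reals all_analysis.
Export Order.TTheory GRing.Theory Num.Theory.
Export numFieldNormedType.Exports.

Set Implicit Arguments.
Unset Strict Implicit.
Unset Printing Implicit Defensive.

Local Open Scope classical_set_scope.
Local Open Scope ring_scope.
Local Open Scope quotient_scope.

(* C^k on an open set W.  For finite-dimensional E, g is C^(k+1) iff it is
   differentiable and x |-> Dg_x(v) is C^k for every fixed vector v. *)
Fixpoint Ck_on {R : realType} {E E' : normedModType R}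
    (k : nat) (W : set E) (g : E -> E') : Prop :=
  match k with
  | 0 => forall x, W x -> {for x, continuous g}
  | k'.+1 => (forall x, W x -> differentiable g x) /\
             forall v : E, Ck_on k' W (fun x => 'd g x v)
  end.

Definition smooth_on {R : realType} {E E' : normedModType R}
    (W : set E) (g : E -> E') : Prop := forall k, Ck_on k W g.

(* A chart is a total function whose values outside chart_dom are irrelevant. *)
Record chart (T : topologicalType) (E : Type) := Chart {
  chart_dom : set T;
  chart_map :> T -> E }.

(* c restricts to a homeomorphism from an open subset of T onto a relatively
   open subset of C. *)
Definition chart_into {T E : topologicalType} (C : set E) (c : chart T E) :=
  [/\ open (chart_dom c),
      {within chart_dom c, continuous c},
      {in chart_dom c &, injective c} &
      forall W : set T, open W -> W `<=` chart_dom c ->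
        exists2 V : set E, open V & c @` W = C `&` V].

(* The map g is smooth on a neighbourhood of c x in the ambient vector space E
   and extends the expression c' \o f \o c^-1 of f in the charts c and c' near
   c x; if c x is a boundary point of the model set, this is the usual meaning
   of smoothness there. *)
Definition local_rep {R : realType} {E E' : normedModType R}
    {T T' : topologicalType} (c : chart T E) (c' : chart T' E')
    (f : T -> T') (x : T) (g : E -> E') : Prop :=
  exists W : set E, [/\ open W, W (c x), smooth_on W g &
    forall y, chart_dom c y -> chart_dom c' (f y) -> W (c y) ->
      g (c y) = c' (f y)].

(* The conditions making the set of charts a smooth atlas are in is_manifold,
   so that products can be formed on the level of raw data. *)
Record charted {R : realType} {E : normedModType R} (C : set E) := Charted {
  carrier :> topologicalType;
  atlas : set (chart carrier E) }.
Arguments atlas {R E C} _.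

Definition is_manifold {R : realType} {E : normedModType R} {C : set E}
    (X : charted C) : Prop :=
  [/\ hausdorff_space X,
      @second_countable X,
      forall c, atlas X c -> chart_into C c,
      forall x : X, exists2 c, atlas X c & chart_dom c x &
      forall c c', atlas X c -> atlas X c' ->
        forall x, chart_dom c x -> chart_dom c' x ->
          exists g, local_rep c c' id x g].

(* Interior in the sense of manifolds (with boundary or corners). *)
Definition manifold_interior {R : realType} {E : normedModType R} {C : set E}
    (X : charted C) : set X :=
  [set x | exists2 c, atlas X c & chart_dom c x /\ C^° (c x)].
Arguments manifold_interior {R E C} _.

Definition half_space {R : realType} (m : nat) : set 'rV[R]_m.+1 :=
  [set x | 0 <= x ord0 ord_max].

Definition prod_chart {T T' : topologicalType} {E E' : Type}
    (c : chart T E) (c' : chart T' E') : chart (T * T')%type (E * E') :=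
  Chart (chart_dom c `*` chart_dom c') (fun p => (c p.1, c' p.2)).

(* If C and C' have boundary, this is the product manifold with corners. *)
Definition prod_charted {R : realType} {E E' : normedModType R}
    {C : set E} {C' : set E'} (X : charted C) (Y : charted C') :
    charted (C `*` C') :=
  @Charted R (E * E')%type (C `*` C') (X * Y)%type
    [set d | exists c c', [/\ atlas X c, atlas Y c' & d = prod_chart c c']].

Definition smooth_map {R : realType} {E E' : normedModType R}
    {C : set E} {C' : set E'} (X : charted C) (Y : charted C')
    (f : X -> Y) : Prop :=
  continuous f /\
  forall c c', atlas X c -> atlas Y c' ->
    forall x, chart_dom c x -> chart_dom c' (f x) ->
      exists g, local_rep c c' f x g.

(* For the model sets used below (closures of open sets) the differential at
   c x does not depend on the smooth extension g. *)
Definition immersive {R : realType} {E E' : normedModType R}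
    {C : set E} {C' : set E'} (X : charted C) (Y : charted C')
    (f : X -> Y) : Prop :=
  forall c c', atlas X c -> atlas Y c' ->
    forall x, chart_dom c x -> chart_dom c' (f x) ->
      exists2 g, local_rep c c' f x g & injective ('d g (c x)).

Definition topological_embedding {X Y : topologicalType} (f : X -> Y) : Prop :=
  [/\ continuous f, injective f &
      forall U : set X, open U ->
        exists2 V : set Y, open V & f @` U = range f `&` V].

Definition smooth_embedding {R : realType} {E E' : normedModType R}
    {C : set E} {C' : set E'} (X : charted C) (Y : charted C')
    (f : X -> Y) : Prop :=
  [/\ smooth_map f, immersive f & topological_embedding f].

Definition unitI (R : realType) : topologicalType := [set` `[0 : R, 1]].

Lemma unitI0_subproof (R : realType) : (0 : R) \in [set` `[0 : R, 1]].
Proof. by rewrite mem_setE in_itv /= lexx ler01. Qed.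

Lemma unitI1_subproof (R : realType) : (1 : R) \in [set` `[0 : R, 1]].
Proof. by rewrite mem_setE in_itv /= lexx ler01. Qed.

Definition unitI0 {R : realType} : unitI R := exist _ 0 (unitI0_subproof R).
Definition unitI1 {R : realType} : unitI R := exist _ 1 (unitI1_subproof R).

Definition unitI_charted (R : realType) : charted ([set` `[0, 1]] : set R^o) :=
  @Charted R R^o [set` `[0, 1]] (unitI R)
    [set Chart setT (fun t : unitI R => set_val t : R^o)].

Definition cylinder {R : realType} {E : normedModType R} {C : set E}
    (X : charted C) := prod_charted X (unitI_charted R).

Record compact_manifold (R : realType) (m : nat) := CompactManifold {
  cm_charted :> charted (@half_space R m);
  cm_manifold : is_manifold cm_charted;
  cm_compact : compact [set: cm_charted] }.

(* Modelled on the whole of R^n, hence without boundary. *)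
Record closed_manifold (R : realType) (n : nat) := ClosedManifold {
  clm_charted :> charted [set: 'rV[R]_n];
  clm_manifold : is_manifold clm_charted;
  clm_compact : compact [set: clm_charted] }.

(* compact_manifold R n has dimension n+1. *)
Definition is_link {R : realType} {n : nat} (F : compact_manifold R n)
    (L : set (cylinder F)) : Prop :=
  [/\ exists (M : closed_manifold R n) (j : M -> cylinder F),
        smooth_embedding j /\ range j = L,
      L `<=` manifold_interior (cylinder F) &
      forall p : cylinder F,
        exists2 q, L q & connected_component [set: cylinder F] p q].

(* The elements of V_n. *)
Record link_pair (R : realType) (n : nat) := LinkPair {
  base : compact_manifold R n;
  link : set (cylinder base);
  link_pairP : is_link link }.
Arguments link {R n} _.

Definition directly_equivalent {R : realType} {n : nat}
    (V1 V2 : link_pair R n) : Prop :=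
  exists2 f : base V1 -> base V2, smooth_embedding f &
    (fun p : cylinder (base V1) => (f p.1, p.2) : cylinder (base V2)) @` link V1
    = link V2.

(* Isotopy through smooth embeddings of one closed manifold M (not an ambient
   isotopy), every stage lying in the interior of F x [0,1] as links do. *)
Definition isotopic {R : realType} {n : nat} (F : compact_manifold R n)
    (L L' : set (cylinder F)) : Prop :=
  exists (M : closed_manifold R n) (J : cylinder M -> cylinder F),
    [/\ smooth_map J,
        forall t : unitI R,
          smooth_embedding (fun x : M => J (x, t)) /\
          range (fun x : M => J (x, t)) `<=` manifold_interior (cylinder F),
        range (fun x : M => J (x, unitI0)) = L &
        range (fun x : M => J (x, unitI1)) = L'].

Inductive virtual_step {R : realType} {n : nat} :
    link_pair R n -> link_pair R n -> Prop :=
| step_direct V1 V2 : directly_equivalent V1 V2 -> virtual_step V1 V2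
| step_isotopy (F : compact_manifold R n) (L L' : set (cylinder F))
    (hL : is_link L) (hL' : is_link L') :
    isotopic L L' -> virtual_step (LinkPair hL) (LinkPair hL').

Definition virtually_equivalent {R : realType} {n : nat} :
    link_pair R n -> link_pair R n -> Prop :=
  clos_refl_sym_trans _ virtual_step.

Section Cone.
Context {R : realType} (X : topologicalType).

Definition cone_rel (p q : X * unitI R) : bool :=
  (p == q) || ((p.2 == unitI1) && (q.2 == unitI1)).

Lemma cone_rel_refl : reflexive cone_rel.
Proof. by move=> p; rewrite /cone_rel eqxx. Qed.

Lemma cone_rel_sym : symmetric cone_rel.
Proof. by move=> p q; rewrite /cone_rel eq_sym andbC. Qed.

Lemma cone_rel_trans : transitive cone_rel.
Proof.
move=> q p r; rewrite /cone_rel => /orP[/eqP->//|/andP[p1 q1]].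
by case/orP=> [/eqP<-|/andP[_ r1]]; rewrite ?p1 ?q1 ?r1 orbT.
Qed.

Canonical cone_equiv := EquivRel cone_rel cone_rel_refl cone_rel_sym cone_rel_trans.

Definition cone : topologicalType :=
  quotient_topology {eq_quot cone_equiv}.

Definition to_cone (p : X * unitI R) : cone := \pi_({eq_quot cone_equiv}) p.

End Cone.

(* The subspace h(F) - L of h(F). *)
Definition h_complement {R : realType} {n : nat} (V : link_pair R n) :
    topologicalType :=
  ~` ((@to_cone R (base V)) @` link V).

Definition homotopic (R : realType) {X Y : topologicalType} (f g : X -> Y) :=
  exists H : X * unitI R -> Y,
    [/\ continuous H, forall x, H (x, unitI0) = f x &
        forall x, H (x, unitI1) = g x].

Definition homotopy_equivalent (R : realType) (X Y : topologicalType) : Prop :=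
  exists (f : X -> Y) (g : Y -> X),
    [/\ continuous f, continuous g,
        homotopic R (g \o f) id & homotopic R (f \o g) id].

(* Main.v *)
(* Direct step f : F1 -> F2.  Links lie over the interior of F1, which f maps
   into the interior U of f(F1).  Take u : F2 -> [0,1] with u = 0 on the
   projection of L2 and u = 1 off U.  The homotopy
   (x, t) |-> (x, t + s u(x) (1 - t)) of h(F2) fixes every line over the
   projection of L2, hence preserves the complement of L2, and it ends by sending
   the lines over F2 - U to the cone point; so it deforms h(F2) - L2 into
   h(F1) - L1.

   Isotopy step J : M x [0,1] -> F x [0,1].  It is enough to compare nearby
   times t0, t.  The move from J(., t0) to J(., t) is split into finitely many
   moves J(., tau) -> J(., sigma), where tau, sigma : M -> [0,1] are close to
   t0, have small Lipschitz constant and differ only inside one chart of M.  In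
   a chart of F x [0,1] such a move displaces the points of the link by a
   1/2-Lipschitz vector field; extended by McShane to a 1/2-Lipschitz field v
   vanishing off a ball, it is realised by the homeomorphism id + v. *)

(* An isotopy of links provides embeddings only, so an ambient map has to be produced. A
   homeomorphism fixing F x {1} pointwise suffices, because it descends to the cone; this avoids
   integrating a vector field. The bound 1/2 has two sources. In the max norm, McShane's formula
   used coordinate by coordinate keeps the Lipschitz constant, and a constant below 1 makes id + v
   bijective by the contraction principle. The moves are split because v lives in a single vector
   space. Nearby times suffice because R is connected, times outside [0,1] being clamped. In the
   direct step it is the cone point that allows a map back: a line over a point outside f(F1) can
   only go to the collapsed top. Continuity there rests on compactness of F1, by which a
   neighbourhood of the cone point contains a whole collar of the top. That f is open at interior
   points uses the equality of dimensions and follows from the same perturbation lemma for id +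
   v. *)
From HB Require Import structures.
From mathcomp Require Import lra.
Require Import Defs.
Set Implicit Arguments.
Unset Strict Implicit.
Unset Printing Implicit Defensive.
Local Open Scope classical_set_scope.
Local Open Scope ring_scope.
Local Open Scope quotient_scope.

(** * Spaces with a max norm *)

(* Coordinates for which the norm is the max norm; they treat R^n and R^n x R
   uniformly. *)
Record sup_coords (R : realType) (E : normedModType R) := SupCoords {
  sc_idx : finType;
  sc_crd : sc_idx -> {linear E -> R^o};
  sc_bas : sc_idx -> E;
  sc_expand : forall v, \sum_j sc_crd j v *: sc_bas j = v;
  sc_dual : forall i j, sc_crd i (sc_bas j) = (i == j)%:R;
  sc_norm_le : forall j v, `|sc_crd j v| <= `|v|;
  sc_le_norm : forall v K, 0 <= K -> (forall j, `|sc_crd j v| <= K) ->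
    `|v| <= K }.

Section Coordinates.
Context {R : realType}.

Definition rV_crd n (j : 'I_n) (v : 'rV[R]_n) : R^o := v ord0 j.

Lemma rV_crd_linear n j : linear (@rV_crd n j).
Proof. by move=> a u v; rewrite /rV_crd !mxE. Qed.

HB.instance Definition _ n j :=
  GRing.isLinear.Build R 'rV[R]_n R^o _ (@rV_crd n j) (rV_crd_linear j).

Definition rV_coords n : sup_coords 'rV[R]_n.
Proof.
refine (@SupCoords R _ 'I_n (fun j => @rV_crd n j) (fun j => delta_mx 0 j)
  _ _ _ _).
- by move=> v; rewrite [RHS]row_sum_delta.
- by move=> i j; rewrite /= /rV_crd mxE eqxx /=.
- move=> j v; rewrite [leRHS]mx_normrE.
  by apply/bigmax_geP; right; exists (ord0, j).
- move=> v K K0 vK; rewrite [leLHS]mx_normrE; apply/bigmax_leP; split=> //.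
  by case=> i j _; rewrite ord1; exact: vK.
Defined.

Definition Ro_coords : sup_coords R^o.
Proof.
refine (@SupCoords R _ unit (fun=> idfun) (fun=> 1) _ _ _ _).
- by move=> v; rewrite big_const card_unit /= addr0 [LHS]mulr1.
- by case; case.
- by [].
- by move=> v K _ /(_ tt).
Defined.

Definition prod_crd (E E' : normedModType R) (c : sup_coords E)
    (c' : sup_coords E') (i : sc_idx c + sc_idx c') (p : E * E') : R^o :=
  match i with inl i => sc_crd i p.1 | inr i => sc_crd i p.2 end.

Lemma prod_crd_linear E E' (c : sup_coords E) (c' : sup_coords E') i :
  linear (@prod_crd E E' c c' i).
Proof. by case: i => i a u v; rewrite /= linearP. Qed.

HB.instance Definition _ (E E' : normedModType R) (c : sup_coords E)
    (c' : sup_coords E') (i : sc_idx c + sc_idx c') :=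
  GRing.isLinear.Build R (E * E')%type R^o _ (@prod_crd E E' c c' i)
    (prod_crd_linear i).

Definition prod_coords (E E' : normedModType R) (c : sup_coords E)
  (c' : sup_coords E') : sup_coords (E * E')%type.
Proof.
refine (@SupCoords R _ (sc_idx c + sc_idx c')%type (fun i => prod_crd i)
  (fun i => match i with inl i => (sc_bas i, 0) | inr i => (0, sc_bas i) end)
  _ _ _ _).
- move=> [u v]; rewrite [LHS]surjective_pairing; congr pair.
    rewrite (big_morph fst (id1 := 0) (op1 := +%R)) // big_sumType /=.
    rewrite [X in _ + X]big1 ?addr0 ?sc_expand // => j _.
    exact: scaler0.
  rewrite (big_morph snd (id1 := 0) (op1 := +%R)) // big_sumType /=.
  rewrite [X in X + _]big1 ?add0r ?sc_expand // => j _.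
  exact: scaler0.
- by move=> [i|i] [j|j] /=; rewrite ?linear0 // sc_dual.
- move=> [i|i] [u v]; rewrite prod_normE le_max /= ?sc_norm_le ?orbT //.
- move=> [u v] K K0 uvK; rewrite prod_normE ge_max /=; apply/andP; split.
    by apply: (@sc_le_norm _ _ c) => // j; exact: (uvK (inl j)).
  by apply: (@sc_le_norm _ _ c') => // j; exact: (uvK (inr j)).
Defined.

End Coordinates.

(** * Strict differentiability *)

Section Differential.
Context {R : realType} {E E' : normedModType R}.

Lemma is_diff_linear (f : {linear E -> E'}) x : continuous f -> is_diff x f f.
Proof.
by move=> cf; apply: DiffDef; [exact: linear_differentiable|exact: diff_lin].
Qed.

Lemma sc_crd_continuous (c : sup_coords E) i : continuous (sc_crd (s := c) i).
Proof.
apply: bounded_linear_continuous; exists 1; split=> // M M1.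
apply/nbhs_ballP; exists 1 => //= v; rewrite -ball_normE /= sub0r normrN => v1.
by rewrite (le_trans (sc_norm_le _ _)) // (le_trans (ltW v1)) // ltW.
Qed.

End Differential.

Section MeanValue.
Context {R : realType} {E E' : normedModType R}.

(** An exact mean value formula holds only for scalar functions, so it is taken one coordinate of
    [E'] at a time; the intermediate [s] depends on [i]. *)
Lemma mean_value_crd (c : sup_coords E') (g : E -> E') (x y : E) i :
  (forall s : R, 0 <= s <= 1 -> differentiable g (y + s *: (x - y))) ->
  exists2 s : R, 0 <= s <= 1 &
    sc_crd i (g x - g y) =
    sc_crd (s := c) i ('d g (y + s *: (x - y)) (x - y)).
Proof.
move=> dg; set w := x - y.
pose p (s : R) : E := y + s *: w.
pose h (s : R) : R := sc_crd i (g (p s)).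
have dp (s : R) : is_diff s p ( *:%R^~ w).
  by have /is_diff_eq := is_diffD (is_diff_cst y s) (is_diff_scalel s w);
    apply; rewrite add0r.
have dh (s : R) : 0 <= s <= 1 ->
    is_derive s 1 h (sc_crd i ('d g (p s) w)).
  move=> /dg/differentiableP dgs.
  have /= dcgp := is_diff_comp (is_diff_comp (dp s) dgs)
    (is_diff_linear _ (@sc_crd_continuous _ _ c i)).
  apply: DeriveDef; first exact/diff_derivable/ex_diff.
  rewrite deriveE; last exact: ex_diff.
  by rewrite (@diff_val _ _ _ _ _ _ _ dcgp) /= scale1r.
have [s| |s s01 hs] := MVT_segment (@ler01 R)
    (f := h) (df := fun s => sc_crd i ('d g (p s) w)).
- by rewrite in_itv /= => /andP[s0 s1]; apply: dh; rewrite !ltW.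
- apply: derivable_within_continuous => s; rewrite in_itv /= => s01.
  by have [] := dh s s01.
exists s; first by rewrite in_itv in s01.
move: hs; rewrite subr0 mulr1 => <-.
by rewrite /h /p scale1r scale0r addr0 /w subrKC linearB.
Qed.

(** By the mean value formula each coordinate of the error is that of ['d g] at an intermediate
    point minus ['d g p], applied to [x - y]. This is small since the finitely many derivatives
    along [sc_bas] are continuous at [p]. *)
Lemma strict_differentiability (c : sup_coords E) (c' : sup_coords E')
    (W : set E) (g : E -> E') (p : E) (eta : R) :
  open W -> W p -> Ck_on 1 W g -> 0 < eta ->
  exists2 r : R, 0 < r & forall x y, ball p r x -> ball p r y ->
    `|g x - g y - 'd g p (x - y)| <= eta * `|x - y|.
Proof.
move=> oW Wp [dg cdg] eta0.
(* One more than the number of basis vectors, hence positive even in dimension 0; the basis errors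
   then add up to at most [eta]. *)
pose N : R := #|sc_idx c|.+1%:R.
have N0 : 0 < N by rewrite ltr0n.
have near_bas (j : sc_idx c) :
    \forall x \near p, `|'d g x (sc_bas j) - 'd g p (sc_bas j)| <= eta / N.
  have /cvgr_dist_le := cdg (sc_bas j) p Wp.
  move=> /(_ (eta / N) (divr_gt0 eta0 N0)); apply: filterS => x.
  by rewrite distrC.
have nW : \forall x \near p, W x by exact: open_nbhs_nbhs.
have /nbhs_ballP[r /= r0 pr] : \forall x \near p, W x /\
    forall j : sc_idx c, `|'d g x (sc_bas j) - 'd g p (sc_bas j)| <= eta / N.
  exact: filterI nW (filter_forall _ near_bas).
exists r => // x y px py.
apply: (@sc_le_norm _ _ c') => [|i]; first by rewrite mulr_ge0 // ltW.
have seg (s : R) : 0 <= s <= 1 -> ball p r (y + s *: (x - y)).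
  move=> /andP[s0 s1]; rewrite -ball_normE /=.
  have -> : p - (y + s *: (x - y)) = (1 - s) *: (p - y) + s *: (p - x).
    rewrite scalerBl scale1r -addrA [- _ + _]addrC -scalerBr opprD addrA.
    rewrite -scalerN; congr (_ + _ *: _).
    by rewrite !opprB [RHS]addrC addrA subrK.
  move: px py; rewrite -!ball_normE /= => px py.
  rewrite (le_lt_trans (ler_normD _ _)) // !normrZ (ger0_norm s0).
  rewrite ger0_norm ?subr_ge0 //.
  have [->|s0'] := eqVneq s 0; first by rewrite subr0 mul1r mul0r addr0.
  have {}s0 : 0 < s by rewrite lt_def s0'.
  have -> : r = (1 - s) * r + s * r by rewrite -mulrDl subrK mul1r.
  by rewrite ler_ltD ?ltr_pM2l // ler_wpM2l ?subr_ge0 // ltW.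
have [s /seg /pr[_ dgs] gs] := mean_value_crd (c := c') i
  (fun s s01 => dg _ (pr _ (seg s s01)).1).
rewrite linearB gs -linearB /= (le_trans (sc_norm_le _ _)) //.
move: (y + s *: (x - y)) dgs => xi dgs; move: (x - y) => v.
have -> : 'd g xi v - 'd g p v =
    \sum_(j : sc_idx c) sc_crd j v *: ('d g xi (sc_bas j) - 'd g p (sc_bas j)).
  have dE q : 'd g q v = \sum_(j : sc_idx c) sc_crd j v *: 'd g q (sc_bas j).
    by rewrite -{1}(sc_expand c v) linear_sum; under eq_bigr do rewrite linearZ.
  rewrite (dE xi) (dE p) -sumrB.
  by apply: eq_bigr => j _; rewrite scalerBr.
rewrite (le_trans (ler_norm_sum _ _ _)) //.
apply: (@le_trans _ _ (\sum_(j : sc_idx c) eta / N * `|v|)).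
  by apply: ler_sum => j _; rewrite normrZ mulrC ler_pM // sc_norm_le.
rewrite sumr_const -mulr_natl mulrA ler_wpM2r // mulrCA ger_pMr //.
by rewrite ler_pdivrMr // mul1r ler_nat.
Qed.
End MeanValue.

(** * Lipschitz perturbations of the identity *)

Section Lipschitz.
Context {R : realType}.

(** Every left end [a k - e k] lies below every right end [a m + e m], so the supremum of the left
    ends lies in all the intervals. This is completeness of [R] in a form that carries an explicit
    error. *)
Lemma nested_sup (a e : nat -> R) :
  (forall k m, (k <= m)%N -> `|a m - a k| <= e k) ->
  exists p, forall k, `|p - a k| <= e k.
Proof.
move=> ae; pose S : set R := [set a k - e k | k in setT].
have ub m : ubound S (a m + e m).
  move=> _ [k _ <-]; case: (leqP k m) => [km|/ltnW mk].
    have := ae _ _ km; have := ae _ _ (leqnn m).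
    by rewrite subrr normr0 ler_norml => em /andP[H _]; lra.
  have := ae _ _ mk; have := ae _ _ (leqnn k).
  by rewrite subrr normr0 ler_norml => ek /andP[_ H]; lra.
have S0 : S !=set0 by exists (a 0 - e 0), 0.
exists (sup S) => k; rewrite ler_norml; apply/andP; split.
  have : a k - e k <= sup S by apply: ub_le_sup; [exists (a 0 + e 0)|exists k].
  lra.
have : sup S <= a k + e k by exact: ge_sup.
lra.
Qed.

Context {E : normedModType R} (c : sup_coords E).

(** Iteration from 0. [E] is not assumed complete: the limit is assembled from its coordinates,
    which [nested_sup] supplies together with the rate of convergence. *)
Lemma contraction_fixpoint (f : E -> E) :
  (forall x y, `|f x - f y| <= 2^-1 * `|x - y|) -> exists x, f x = x.
Proof.
move=> fc; pose x k := iter k f 0; pose D := `|f 0|.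
have D0 : 0 <= D by exact: normr_ge0.
have x0 i : `|x i| <= 2 * D.
  elim: i => [|i ih]; first by rewrite normr0 mulr_ge0.
  rewrite -[x i.+1](subrK (f 0)) (le_trans (ler_normD _ _)) //.
  have := fc (x i) 0; rewrite subr0 /= -/(x i) -/D => H.
  by rewrite /x /= -/(x i); lra.
have xk k i : `|x (i + k)%N - x k| <= 2^-1 ^+ k * (2 * D).
  elim: k => [|k ih]; first by rewrite addn0 subr0 expr0 mul1r.
  rewrite addnS exprS /x /= -/(x (i + k)) -/(x k) (le_trans (fc _ _)) //.
  by rewrite -mulrA ler_wpM2l // invr_ge0.
have /choice[q qP] (j : sc_idx c) : exists q : R, forall k,
    `|q - sc_crd j (x k)| <= 2^-1 ^+ k * (2 * D).
  apply: nested_sup => k m km; rewrite -linearB (le_trans (sc_norm_le _ _)) //.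
  by rewrite -(subnK km).
pose p := \sum_j q j *: sc_bas j.
have pk k : `|p - x k| <= 2^-1 ^+ k * (2 * D).
  apply: (@sc_le_norm _ _ c) => [|j].
    by rewrite mulr_ge0 ?exprn_ge0 ?invr_ge0 ?mulr_ge0.
  rewrite linearB /p linear_sum (bigD1 j) //= linearZ /= sc_dual eqxx.
  rewrite big1 => [|i ij]; last first.
    by rewrite linearZ /= sc_dual eq_sym (negbTE ij) /GRing.scale /= mulr0.
  by rewrite addr0 [_ *: _]mulr1.
exists p; apply/eqP; rewrite -subr_eq0 -normr_eq0 eq_le normr_ge0 andbT.
have H k : `|f p - p| <= 2^-1 ^+ k * (4 * D).
  rewrite -(subrKA (x k.+1)) (le_trans (ler_normD _ _)) //.
  have := pk k.+1; rewrite distrC exprS; have := fc p (x k); have := pk k.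
  rewrite /= -/(x k); have : 0 <= 2^-1 ^+ k :> R by rewrite exprn_ge0.
  move: (_ ^+ k) => t; nra.
have : 2^-1 ^+ k * (4 * D) @[k --> \oo] --> (0 : R).
  rewrite -[X in _ --> X](mul0r (4 * D)); apply: cvgMl.
  by apply: cvg_expr; rewrite ger0_norm // invf_lt1 // ltr1n.
move=> cvg0; rewrite -(cvg_lim _ cvg0) //; apply: limr_ge; last exact: nearW.
exact: cvgP cvg0.
Qed.

(* McShane's formula, applied to each coordinate. *)
Lemma lipschitz_extension (k : R) (G : set (E * E)) : 0 <= k ->
  (forall p q, G p -> G q -> `|p.2 - q.2| <= k * `|p.1 - q.1|) ->
  exists2 v : E -> E, forall x y, `|v x - v y| <= k * `|x - y| &
    forall p, G p -> v p.1 = p.2.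
Proof.
(* An empty [G] is treated apart, since the infimum in McShane's formula needs a nonempty set. *)
move=> k0 GL; have [[p0 Gp0]|/set0P/negP/negPn/eqP->] := pselect (G !=set0);
  last first.
  by exists (cst 0) => // x y; rewrite subrr normr0 mulr_ge0.
pose S j x : set R := [set sc_crd (s := c) j q.2 + k * `|x - q.1| | q in G].
have S0 j x : S j x !=set0 by exists (sc_crd j p0.2 + k * `|x - p0.1|), p0.
have lbS j x p : G p -> lbound (S j x) (sc_crd j p.2 - k * `|x - p.1|).
  move=> Gp _ [q Gq <-].
  have := le_trans (sc_norm_le j (p.2 - q.2)) (GL _ _ Gp Gq).
  rewrite linearB ler_norml => /andP[_ H].
  have : k * `|p.1 - q.1| <= k * (`|x - p.1| + `|x - q.1|).
    rewrite ler_wpM2l // -(subrKA x) (le_trans (ler_normD _ _)) //.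
    by rewrite (distrC p.1).
  by rewrite mulrDr /=; lra.
have hlb j x : has_lbound (S j x) by eexists; exact: lbS Gp0.
pose v x := \sum_j inf (S j x) *: sc_bas j.
have crdv j x : sc_crd j (v x) = inf (S j x).
  rewrite /v linear_sum (bigD1 j) //= linearZ /= sc_dual eqxx.
  rewrite big1 => [|i ij]; last first.
    by rewrite linearZ /= sc_dual eq_sym (negbTE ij) /GRing.scale /= mulr0.
  by rewrite addr0 [_ *: _]mulr1.
have crd_inj (u w : E) : (forall j, sc_crd (s := c) j u = sc_crd j w) -> u = w.
  move=> uw; rewrite -(sc_expand c u) -(sc_expand c w).
  by apply: eq_bigr => j _; rewrite uw.
have half j x y : inf (S j x) <= inf (S j y) + k * `|x - y|.
  rewrite -lerBlDr; apply: lb_le_inf => // _ [q Gq <-].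
  have : inf (S j x) <= sc_crd j q.2 + k * `|x - q.1|.
    by apply: ge_inf => //; exists q.
  have : k * `|x - q.1| <= k * (`|x - y| + `|y - q.1|).
    by rewrite ler_wpM2l // -(subrKA y) ler_normD.
  by rewrite mulrDr; lra.
exists v => [x y|p Gp].
  apply: (@sc_le_norm _ _ c) => [|j]; first by rewrite mulr_ge0.
  rewrite linearB /= !crdv ler_norml; apply/andP; split.
    by have := half j y x; rewrite distrC; lra.
  by have := half j x y; lra.
apply: crd_inj => j; rewrite crdv; apply/le_anti/andP; split.
  by apply: ge_inf => //; exists p => //; rewrite subrr normr0 mulr0 addr0.
apply: lb_le_inf => //.
by have := lbS j p.1 p Gp; rewrite subrr normr0 mulr0 subr0.
Qed.

Lemma lipschitz_continuous (k : R) (E' : normedModType R) (f : E' -> E) :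
  (forall x y, `|f x - f y| <= k * `|x - y|) -> continuous f.
Proof.
move=> fk x; pose K := `|k| + 1.
have K0 : 0 < K by rewrite ltr_wpDl.
apply/cvgrPdist_le => e e0; near=> y.
rewrite (le_trans (fk _ _)) // (@le_trans _ _ (K * `|x - y|)) //.
  by rewrite ler_wpM2r // /K (le_trans (ler_norm k)) // lerDl.
rewrite mulrC -ler_pdivlMr //; near: y.
by apply: cvgr_dist_le; [exact: cvg_id|exact: divr_gt0].
Unshelve. all: by end_near. Qed.

(** A solution of [x + v x = y] is a fixed point of the contraction sending [x] to [y - v x].
    Distances shrink by at most a factor 2 under [x + v x], so the inverse is 2-Lipschitz. *)
Lemma perturbed_identity (v : E -> E) :
  (forall x y, `|v x - v y| <= 2^-1 * `|x - y|) ->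
  exists h, [/\ continuous (fun x => x + v x), continuous h,
    cancel (fun x => x + v x) h & cancel h (fun x => x + v x)].
Proof.
move=> vk; pose f x := x + v x.
have f2 x y : `|x - y| <= 2 * `|f x - f y|.
  have -> : x - y = (f x - f y) - (v x - v y).
    by rewrite /f opprD addrACA addrK.
  have := ler_normB (f x - f y) (v x - v y); have := vk x y.
  have {1}-> : x - y = (f x - f y) - (v x - v y).
    by rewrite /f opprD addrACA addrK.
  lra.
have /choice[h hK] (y : E) : exists x, f x = y.
  have [|x xE] := @contraction_fixpoint (fun x => y - v x).
    by move=> a b; rewrite opprB addrC addrA subrK distrC.
  by exists x; rewrite /f -{1}xE subrK.
have fK : cancel f h.
  move=> x; apply/eqP; rewrite -subr_eq0 -normr_le0.
  by rewrite (le_trans (f2 _ _)) // hK subrr normr0 mulr0.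
exists h; split=> //.
  move=> x; apply: cvgD; first exact: cvg_id.
  exact: (lipschitz_continuous vk).
by apply: (@lipschitz_continuous 2) => x y; rewrite -{2}(hK x) -{2}(hK y).
Qed.
End Lipschitz.

(** * Homeomorphisms supported in a chart *)

(** A chart around interior points only: by the last clause [d] is open on [O] as a map into the
    whole of [E], so no half space or corner enters. Smoothness is left to separate estimates. *)
Definition euclidean_chart (Z E : topologicalType) (O : set Z) (d : Z -> E) :=
  [/\ open O, forall z, O z -> {for z, continuous d}, {in O &, injective d} &
      forall z U, O z -> nbhs z U -> nbhs (d z) (d @` U)].

Lemma compact_closure_subset (Z : topologicalType) (z : Z) (U : set Z) :
  hausdorff_space Z -> compact [set: Z] -> nbhs z U ->
  exists2 B, nbhs z B & closure B `<=` U.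
Proof.
move=> hZ cZ zU.
have [B zB BU] := compact_regular hZ cZ filterT zU.
by exists B.
Qed.

Section ChartHomeo.
Context {R : realType} {Z : topologicalType} {E : normedModType R}.
Variables (O : set Z) (d : Z -> E) (p : Z).
Hypotheses (hZ : hausdorff_space Z) (cZ : compact [set: Z]).
Hypotheses (dO : euclidean_chart O d) (Op : O p).

(** [h] is conjugated by [d] and extended by the identity. The ball is taken inside the image of a
    neighbourhood [B] with closure in [O]; since nothing moves off [B], every point outside [O] has
    a neighbourhood on which [H] is the identity. *)
Lemma chart_transfer_map : exists2 r : R, 0 < r & forall h h' : E -> E,
  continuous h -> cancel h h' -> (forall w, ~ ball (d p) r w -> h w = w) ->
  exists H : Z -> Z, [/\ continuous H, forall z, ~ O z -> H z = z &
    forall z, O z -> O (H z) /\ d (H z) = h (d z)].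
Proof.
have [oO dc dI dop] := dO.
have injd y z : O y -> O z -> d y = d z -> y = z.
  by move=> Oy Oz; apply: dI; rewrite inE.
have [B pB clB] := compact_closure_subset hZ cZ (open_nbhs_nbhs (conj oO Op)).
have /nbhs_ballP[r /= r0 rB] := dop _ _ Op pB.
exists r => // h h' ch hK hball.
(* If [h w] left the ball, it would be fixed by [h], and injectivity would give [h w = w]. *)
have ballh w : ball (d p) r w -> ball (d p) r (h w).
  move=> pw; apply: contrapT => nb; apply: (nb).
  by rewrite -(can_inj hK (hball _ nb)) in pw.
have Hex z : exists z', (~ O z -> z' = z) /\
    (O z -> O z' /\ d z' = h (d z)).
  have [Oz|nOz] := pselect (O z); last by exists z; split.
  have [bz|nbz] := pselect (ball (d p) r (d z)); last first.
    by exists z; split=> // _; rewrite hball.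
  have [z' Bz' dz'] := rB _ (ballh _ bz).
  by exists z'; split=> // _; split=> //; exact/clB/subset_closure.
have /choice[H HP] := Hex.
exists H; split; [|by move=> z /(HP z).1|by move=> z /(HP z).2].
move=> z; have [Oz|nOz] := pselect (O z).
  move=> U zU; have [OHz dHz] := (HP z).2 Oz.
  have nO (y : Z) : O y -> nbhs y O by move=> Oy; exact: open_nbhs_nbhs.
  have nhd : nbhs (h (d z)) (d @` (U `&` O)).
    by rewrite -dHz; apply: dop => //; apply: filterI => //; exact: nO.
  have hdc : {for z, continuous (h \o d)}.
    by apply: continuous_comp; [exact: dc|exact: ch].
  apply: filterS (filterI (nO _ Oz) (hdc _ nhd)) => y [Oy [u [Uu Ou] du]].
  have [OHy dHy] := (HP y).2 Oy.
  by rewrite /= -(injd u _ Ou OHy) //; rewrite du dHy.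
have nz : nbhs z (~` B).
  rewrite -[nbhs z _]/((~` B)^° z) interiorC.
  by move=> /clB.
move=> U; rewrite (HP z).1 // => zU.
apply: filterS (filterI nz zU) => y [nBy Uy] /=.
suff -> : H y = y by [].
have [Oy|nOy] := pselect (O y); last exact: (HP y).1.
have [OHy dHy] := (HP y).2 Oy.
apply: (injd) => //; rewrite dHy hball // => /rB[y' By' /injd yE].
by apply: nBy; rewrite -yE //; exact/clB/subset_closure.
Qed.

Lemma chart_homeo : exists2 r : R, 0 < r & forall h h' : E -> E,
  continuous h -> continuous h' -> cancel h h' -> cancel h' h ->
  (forall w, ~ ball (d p) r w -> h w = w) ->
  exists H H' : Z -> Z, [/\ continuous H, continuous H', cancel H H',
    cancel H' H & (forall z, ~ O z -> H z = z) /\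
    forall z, O z -> O (H z) /\ d (H z) = h (d z)].
Proof.
have [oO dc dI dop] := dO.
have [r r0 rP] := chart_transfer_map.
exists r => // h h' ch ch' hK h'K hball.
have [H [cH HN HO]] := rP h h' ch hK hball.
have [w nbw|H' [cH' H'N H'O]] := rP h' h ch' h'K.
  by rewrite -{1}(hball w nbw) hK.
exists H, H'; split=> //.
  move=> z; have [Oz|nOz] := pselect (O z); last by rewrite HN // H'N.
  have [OHz dHz] := HO _ Oz; have [OH'z dH'z] := H'O _ OHz.
  by apply: dI; rewrite ?inE // dH'z dHz hK.
move=> z; have [Oz|nOz] := pselect (O z); last by rewrite H'N // HN.
have [OHz dHz] := H'O _ Oz; have [OH'z dH'z] := HO _ OHz.
by apply: dI; rewrite ?inE // dH'z dHz h'K.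
Qed.

End ChartHomeo.

Section AmbientEquiv.
Context {Z : topologicalType}.
Implicit Types T A B C : set Z.

(** [T] will be the top F x {1}; fixing it pointwise is what lets [H] and [H'] descend to the
    cone. *)
Definition ambient_equiv T A B := exists H H' : Z -> Z,
  [/\ continuous H, continuous H', cancel H H', cancel H' H &
      (forall z, T z -> H z = z) /\ H @` A = B].

Lemma ambient_equiv_refl T A : ambient_equiv T A A.
Proof.
by exists id, id; split=> //; [move=> z; exact: cvg_id..|rewrite image_id].
Qed.

Lemma ambient_equiv_sym T A B : ambient_equiv T A B -> ambient_equiv T B A.
Proof.
move=> [H [H' [cH cH' HK H'K [HT <-]]]]; exists H', H; split=> //; split.
  by move=> z /HT Hz; rewrite -[in LHS]Hz HK.
rewrite image_comp (_ : H' \o H = id) ?image_id //.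
by apply/funext => z /=; rewrite HK.
Qed.

Lemma ambient_equiv_trans T A B C :
  ambient_equiv T A B -> ambient_equiv T B C -> ambient_equiv T A C.
Proof.
move=> [H [H' [cH cH' HK H'K [HT <-]]]] [G [G' [cG cG' GK G'K [GT <-]]]].
exists (G \o H), (H' \o G'); split.
- by move=> z; apply: continuous_comp; [exact: cH|exact: cG].
- by move=> z; apply: continuous_comp; [exact: cG'|exact: cH'].
- by move=> z /=; rewrite GK HK.
- by move=> z /=; rewrite H'K G'K.
- split; last by rewrite image_comp.
  by move=> z Tz /=; rewrite HT // GT.
Qed.

End AmbientEquiv.

(** * Moving a family of embeddings inside a chart *)

Section LocalPush.
Context {R : realType} {Z M : topologicalType} {E E' : normedModType R}.
Variables (T : set Z) (J : M -> R -> Z).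

(* What joint C^1 smoothness and immersivity of the stage t0 give near
   (x, t0). *)
Definition tame (x : M) (t0 : R) (phi : M -> E) :=
  exists (O : set Z) (d : Z -> E') (m C : R),
  [/\ euclidean_chart O d, O (J x t0), O `&` T = set0, 0 < m & 0 <= C] /\
  exists (N : set M) (e : R), [/\ nbhs x N, 0 < e &
    forall t s, `|t - t0| < e -> `|s - t0| < e ->
    forall y z, N y -> N z ->
    [/\ O (J y t),
        m * `|phi y - phi z| <= `|d (J y t) - d (J z t)|,
        `|d (J y t) - d (J y s)| <= C * `|t - s| &
        `|(d (J y t) - d (J z t)) - (d (J y s) - d (J z s))|
          <= m / 8 * `|phi y - phi z| ]].

Hypotheses (hZ : hausdorff_space Z) (cZ : compact [set: Z]).
Hypotheses (hM : hausdorff_space M) (cM : compact [set: M]).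
Hypothesis cJ : continuous (fun q : M * R => J q.1 q.2).

(** Points of [M] away from [x] may still have images in the chart [O]; this keeps them off the ball
    in which a push acts. At time [t0] it is Hausdorff separation, and compactness of [K] makes
    radius and time range uniform. *)
Lemma separate_far (O : set Z) (d : Z -> E') (x : M) (t0 : R) (K : set M) :
  euclidean_chart O d -> O (J x t0) -> compact K ->
  (forall y, K y -> J y t0 <> J x t0) ->
  exists2 e : R, 0 < e & forall y t, K y -> `|t - t0| < e -> O (J y t) ->
    ~ ball (d (J x t0)) e (d (J y t)).
Proof.
move=> [oO dc dI dop] Ox cK Kx.
pose P (e : R) (y : M) := forall t, `|t - t0| < e -> O (J y t) ->
    ~ ball (d (J x t0)) e (d (J y t)).
have : \forall e \near 0^'+, K `<=` P e.
  apply: (compact_near_coveringP K).1 => // y Ky.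
  have : J y t0 != J x t0 by apply/eqP/Kx.
  have := hZ; rewrite open_hausdorff => /[apply].
  move=> [[U V] /= [yU xV] [oU oV /eqP UV]].
  have nU : nbhs (J y t0) U.
    by apply: open_nbhs_nbhs; split=> //; rewrite inE in yU.
  have nV : nbhs (J x t0) (V `&` O).
    apply: open_nbhs_nbhs; split; first exact: openI.
    by rewrite inE in xV.
  have /nbhs_ballP[r /= r0 rV] := dop _ _ Ox nV.
  have [[A B] /= [yA tB] ABU] :
    nbhs (y, t0) ((fun q : M * R => J q.1 q.2) @^-1` U) by exact: cJ.
  have [e /= e0 eB] := (nbhs_ballP _ _).1 tB.
  exists (A, [set i | i < Num.min e r]).
    by split=> //=; apply: nbhs_right_lt; rewrite lt_min e0.
  move=> [y' i] /= [Ay']; rewrite lt_min => /andP[ie ir] t ti Oy' bt.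
  have Ut : U (J y' t).
    apply: (ABU (y', t)); split=> //=; apply: eB.
    by rewrite -ball_normE /= distrC (lt_trans ti).
  have [z [Vz Oz] dz] := rV _ (le_ball (ltW ir) bt).
  have zE : z = J y' t by apply: dI; rewrite ?inE.
  by rewrite zE in Vz; have : (U `&` V) (J y' t) by []; rewrite UV.
move=> nP; near (0 : R)^'+ => e; exists e; first by [].
by move=> y t Ky; apply: (near nP e).
Unshelve. all: by end_near. Qed.

(** The displacement is prescribed on two sets of the chart: from stage [tau] to stage [sigma] at
    the points coming from [A], and 0 outside the ball of radius [2 * r]. This prescription is
    1/2-Lipschitz, so it extends. Times differ only on the smaller [N], whose points stay within [r]
    of the centre and so keep a margin [r] from the fixed region. *)
Lemma local_push (c : sup_coords E') (x : M) (t0 : R) (phi : M -> E)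
    (D : set M) :
  tame x t0 phi -> nbhs x D -> (forall y, J y t0 = J x t0 -> y = x) ->
  exists (A N : set M) (kappa e : R),
    [/\ closed A, A `<=` D, nbhs x N, 0 < kappa & 0 < e] /\
    forall tau sigma : M -> R,
      (forall y, `|tau y - t0| < e) -> (forall y, `|sigma y - t0| < e) ->
      (forall y, ~ N y -> tau y = sigma y) ->
      (forall y z, A y -> A z ->
        `|tau y - tau z| <= kappa * `|phi y - phi z|) ->
      (forall y z, A y -> A z ->
        `|sigma y - sigma z| <= kappa * `|phi y - phi z|) ->
      ambient_equiv T (range (fun y => J y (tau y)))
                      (range (fun y => J y (sigma y))).
Proof.
move=> [ O [d [m [C [[dO Ox OT m0 C0] [N0 [e0 [xN0 e0_gt0 tm]]]]]]]] xD Jinj.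
have [oO dc dI dop] := dO.
have [B xB clB] := compact_closure_subset hM cM (filterI xN0 xD).
set A := closure B.
have AN0 y : A y -> N0 y by move=> /clB[].
have xA : nbhs x A by apply: filterS xB; exact: subset_closure.
have [e1 e1_gt0 far] : exists2 e : R, 0 < e & forall y t, (~` A°) y ->
    `|t - t0| < e -> O (J y t) -> ~ ball (d (J x t0)) e (d (J y t)).
  apply: separate_far => //.
    rewrite -(setTI (~` A°)); apply: compact_closedI => //.
    by apply: open_closedC; exact: open_interior.
  by move=> y nAy /Jinj yx; apply: nAy; rewrite yx.
have [r0 r0_gt0 push] := chart_homeo hZ cZ dO Ox.
set p := d (J x t0) in far push *.
pose r : R := Num.min e1 r0 / 2.
have r_gt0 : 0 < r by rewrite divr_gt0 // lt_min e1_gt0.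
have r2E : 2 * r = Num.min e1 r0 by rewrite mulrC divfK.
have r2e1 : 2 * r <= e1 by rewrite r2E ge_min lexx.
have r2r0 : 2 * r <= r0 by rewrite r2E ge_min lexx orbT.
clearbody r.
have dJc : {for (x, t0), continuous (d \o (fun q : M * R => J q.1 q.2))}.
  by apply: continuous_comp; [exact: cJ|exact: dc].
have [[N1 B1] /= [xN1 tB1] NB1] := dJc _ (nbhsx_ballx p r r_gt0).
have [e2 /= e2_gt0 eB1] := (nbhs_ballP _ _).1 tB1.
(* [kappa] makes each time variation contribute at most [m / 8], and [e3] makes a displacement at
   most [r / 2]. Dividing by [C + 1] covers [C = 0]. *)
pose C1 := C + 1; have C1_gt0 : 0 < C1 by rewrite ltr_wpDl.
pose kappa := m / 8 / C1.
have kappa_gt0 : 0 < kappa by rewrite !divr_gt0.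
have Ckappa : C * kappa <= m / 8.
  rewrite /kappa mulrCA ger_pMr ?divr_gt0 // ler_pdivrMr // mul1r /C1; lra.
pose e3 : R := r / 4 / C1.
have e3_gt0 : 0 < e3 by rewrite !divr_gt0.
have Ce3 : C * e3 <= r / 4.
  rewrite /e3 mulrCA ger_pMr ?divr_gt0 // ler_pdivrMr // mul1r /C1; lra.
pose e := Num.min (Num.min e0 e1) (Num.min e2 e3).
have e_gt0 : 0 < e by rewrite /e !lt_min e0_gt0 e1_gt0 e2_gt0 e3_gt0.
have [ee0 ee1 ee2 ee3] : [/\ e <= e0, e <= e1, e <= e2 & e <= e3].
  by rewrite /e !ge_min !lexx !orbT.
exists A, (N1 `&` A), kappa, e; split.
  split=> //; [exact: closed_closure|by move=> y /clB[]|exact: filterI].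
move=> tau sigma taue sigmae tausigma tauk sigmak.
have inO y (rho : M -> R) : A y -> (forall y, `|rho y - t0| < e) ->
    O (J y (rho y)).
  move=> Ay rhoe; have H := lt_le_trans (rhoe y) ee0.
  by have [] := tm _ _ H H y y (AN0 _ Ay) (AN0 _ Ay).
pose f y := d (J y (tau y)); pose g y := d (J y (sigma y)).
(* The displacements differ by at most three errors of [m / 8] times the [phi]-distance, while [f y]
   and [f z] are at least [7 / 8 * m] times that distance apart; and [3 / 8 <= 7 / 16]. *)
have fg_lip y z : A y -> A z ->
    `|(g y - f y) - (g z - f z)| <= 2^-1 * `|f y - f z|.
  move=> Ay Az; have [N0y N0z] := (AN0 _ Ay, AN0 _ Az).
  have lt0 (u : R) : `|u| < e -> `|u| < e0 by move=> /lt_le_trans; exact.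
  have [[[ty tz] sy] sz] := (lt0 _ (taue y), lt0 _ (taue z), lt0 _ (sigmae y),
    lt0 _ (sigmae z)).
  have [_ lb _ _] := tm _ _ ty ty _ _ N0y N0z.
  have [_ _ _ sd] := tm _ _ sy ty _ _ N0y N0z.
  have [_ _ tyz _] := tm _ _ ty tz _ _ N0z N0z.
  have [_ _ syz _] := tm _ _ sy sz _ _ N0z N0z.
  have {}tyz := le_trans tyz (ler_wpM2l C0 (tauk _ _ Ay Az)).
  have {}syz := le_trans syz (ler_wpM2l C0 (sigmak _ _ Ay Az)).
  rewrite mulrA in tyz; rewrite mulrA in syz.
  have k8 : C * kappa * `|phi y - phi z| <= m / 8 * `|phi y - phi z|.
    by rewrite ler_wpM2r.
  set a1 := d (J y (sigma y)) - d (J z (sigma y)) in sd.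
  set a2 := d (J y (tau y)) - d (J z (tau y)) in sd lb.
  set b1 := d (J z (sigma y)) - d (J z (sigma z)) in syz.
  set b2 := d (J z (tau y)) - d (J z (tau z)) in tyz.
  have -> : g y - f y - (g z - f z) = (a1 - a2) + b1 - b2.
    rewrite (addrAC a1) -(addrA (a1 + b1)) -opprD !subrKA !opprB.
    rewrite -/(f y) -/(f z).
    by rewrite addrACA [RHS]addrACA [- f y - _]addrC.
  have fE : f y - f z = a2 + b2 by rewrite /a2 /b2 subrKA.
  have h1 := ler_normB (a1 - a2 + b1) b2.
  have h2 := ler_normD (a1 - a2) b1.
  have h3 : `|a2| <= `|f y - f z| + `|b2|.
    by rewrite -[a2](addrK b2) -fE ler_normB.
  have mphi : 0 <= m * `|phi y - phi z| by rewrite mulr_ge0 // ltW.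
  lra.
pose G : set (E' * E') := [set q | (exists2 y, A y & q = (f y, g y - f y)) \/
  (~ ball p (2 * r) q.1 /\ q.2 = 0)].
(* A point that moves lies within [r] of [p] and [w] is at least [2 * r] away, so they are at least
   [r] apart, twice the largest displacement. Points of [A] outside [N] do not move. *)
have Gmixed y w : A y -> ~ ball p (2 * r) w ->
    `|g y - f y| <= 2^-1 * `|f y - w|.
  move=> Ay nw; have [Ny|nN] := pselect ((N1 `&` A) y); last first.
    by rewrite /g /f tausigma // subrr normr0 mulr_ge0.
  have fy : ball p r (f y).
    apply: (NB1 (y, tau y)); split=> /=; first by case: Ny.
    by apply: eB1; rewrite -ball_normE /= distrC (lt_le_trans (taue y)).
  have wr : 2 * r <= `|p - w|.
    by rewrite leNgt; apply/negP; move: nw; rewrite -ball_normE.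
  have H0 (u : R) : `|u| < e -> `|u| < e0 by move=> /lt_le_trans; exact.
  have [_ _ gf _] := tm _ _ (H0 _ (sigmae y)) (H0 _ (taue y))
    _ _ (AN0 _ Ay) (AN0 _ Ay).
  have st : `|sigma y - tau y| <= 2 * e3.
    have := ler_normB (sigma y - t0) (tau y - t0); rewrite opprB subrKA.
    by have := sigmae y; have := taue y; lra.
  have := ler_wpM2l C0 st; rewrite mulrCA => Cst.
  have fw : `|p - w| <= `|p - f y| + `|f y - w|.
    by rewrite -(subrKA (f y)) ler_normD.
  have {}fy : `|p - f y| < r by move: fy; rewrite -ball_normE.
  have {}gf : `|g y - f y| <= C * `|sigma y - tau y| := gf.
  lra.
have [v vlip vG] : exists2 v : E' -> E',
    forall x y, `|v x - v y| <= 2^-1 * `|x - y| &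
    forall q, G q -> v q.1 = q.2.
  apply: (lipschitz_extension c) => //.
  move=> q q' [[y Ay ->]|[nq ->]] [[z Az ->]|[nq' ->]] /=.
  - exact: fg_lip.
  - by rewrite subr0; exact: Gmixed.
  - by rewrite sub0r normrN [in leRHS]distrC; exact: Gmixed.
  - by rewrite subr0 normr0 mulr_ge0.
have v0 w : ~ ball p (2 * r) w -> v w = 0.
  by move=> nw; apply: (vG (w, 0)); right.
have [h [ch ch' hK h'K]] := perturbed_identity c vlip.
have [w nw|H [H' [cH cH' HK H'K [HN HO]]]] := push _ _ ch ch' hK h'K.
  by rewrite v0 ?addr0 // => /(le_ball r2r0).
exists H, H'; split=> //; split.
  by move=> z Tz; apply: HN => Oz; have : (O `&` T) z by []; rewrite OT.
have HJ y : H (J y (tau y)) = J y (sigma y).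
  have [Ay|nAy] := pselect (A y).
    have [OHz dHz] := HO _ (inO _ _ Ay taue).
    apply: dI; rewrite ?inE //; first exact: inO.
    by rewrite dHz (vG (f y, g y - f y)) ?subrKC //; left; exists y.
  (* Outside [A] both times agree, and by [far] the stage point is off the chart or off the ball of
     radius [e1 >= 2 * r], where [v] vanishes. *)
  rewrite -tausigma; last by move=> [].
  have [Oy|nOy] := pselect (O (J y (tau y))); last exact: HN.
  have [OHz dHz] := HO _ Oy.
  apply: dI; rewrite ?inE // dHz v0 ?addr0 // => /(le_ball r2e1).
  apply: far => //; first by move=> /interior_subset.
  exact: lt_le_trans (taue y) ee1.
apply/seteqP; split=> [_ [_ [y _ <-] <-]|_ [y _ <-]].
  by exists y => //; rewrite HJ.
by exists (J y (tau y)); [exists y|rewrite HJ].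
Qed.
End LocalPush.

(** Near-covering compactness is applied to the filter generated by the lists that contain a given
    finite list; for this filter [x \in s] holds eventually. *)
Lemma compact_finite_cover (M : topologicalType) (B : M -> set M) :
  compact [set: M] -> (forall x, nbhs x (B x)) ->
  exists s : seq M, forall y, exists2 x, x \in s & B x y.
Proof.
move=> cM xB.
pose F : set_system (seq M) := [set Q : set (seq M) |
  exists s0 : seq M, forall s : seq M, {subset s0 <= s} -> Q s].
have FF : Filter F.
  split=> [|P Q [s sP] [s' sQ]|P Q PQ [s sP]]; first by exists [::].
    exists (s ++ s') => u su; split; [apply: sP|apply: sQ] => x xs;
      by apply: su; rewrite mem_cat xs ?orbT.
  by exists s => u /sP /PQ.
pose P (s : seq M) y := exists2 x, x \in s & B x y.
have [s sP] : F [set s | [set: M] `<=` P s].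
  apply: ((compact_near_coveringP _).1 cM _ F P FF) => x _.
  exists (B x, [set s : seq M | x \in s]);
    last by move=> [y s] [] /= Bxy xs; exists x.
  split; first exact: xB.
  by exists [:: x] => s; apply; rewrite inE.
by exists s => y; apply: (sP s).
Qed.

(** The class of a point is open by the local hypothesis, its complement is open by symmetry and
    transitivity, and the line is connected. *)
Lemma locally_constant_real (R : realType) (P : R -> R -> Prop) :
  (forall x y, P x y -> P y x) -> (forall x y z, P x y -> P y z -> P x z) ->
  (forall x, \forall y \near x, P x y) -> forall x y, P x y.
Proof.
move=> Psym Ptrans Ploc a b.
have Prefl x : P x x by exact: nbhs_singleton (Ploc x).
have oP : open [set y | P a y].
  rewrite openE => y /= ay; have := Ploc y; apply: filterS => z.
  exact: Ptrans.
have cP : closed [set y | P a y].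
  rewrite -openC openE => y /= ay; have := Ploc y; apply: filterS => z yz az.
  by apply: ay; apply: Ptrans az (Psym _ _ yz).
have cT : connected [set: R] by apply/connected_intervalP.
suff PT : [set y | P a y] = setT.
  by have : [set: R] b by []; rewrite -PT.
by apply: cT; [exists a|exists [set y | P a y]; rewrite ?setTI..].
Qed.

Section IsotopyPush.
Context {R : realType} {M : topologicalType} {E : normedModType R}.
Variables (phi : M -> M -> E) (D : M -> set M).
Hypothesis cM : compact [set: M].
Hypothesis phi_cont : forall x y, D x y -> {for y, continuous (phi x)}.
Hypothesis phi_inj : forall x, {in D x &, injective (phi x)}.

(** [M] carries no metric, so the Lipschitz condition is imposed locally in every chart [phi x]: a
    push at [x] measures in [phi x] also the cutoffs built at other points. *)
Definition cutoff (rho : M -> R) := (forall y, 0 <= rho y <= 1) /\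
  forall x y, D x y -> exists2 V, nbhs y V & exists K, forall z w,
    V z -> V w -> `|rho z - rho w| <= K * `|phi x z - phi x w|.

Lemma cutoff0 : cutoff (cst 0).
Proof.
split=> [y|x y _]; first by rewrite lexx ler01.
exists setT; first exact: filterT.
by exists 0 => z w _ _; rewrite subrr normr0 mul0r.
Qed.

Lemma max_dist (a b a' b' k : R) : `|a - a'| <= k -> `|b - b'| <= k ->
  `|Num.max a b - Num.max a' b'| <= k.
Proof.
by rewrite !ler_norml; case: (leP a b); case: (leP a' b') => h1 h2
  /andP[h3 h4] /andP[h5 h6]; apply/andP; split; lra.
Qed.

Lemma cutoff_max rho rho' : cutoff rho -> cutoff rho' ->
  cutoff (fun y => Num.max (rho y) (rho' y)).
Proof.
move=> [r01 rL] [r01' rL']; split=> [y|x y Dy].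
  rewrite le_max ge_max.
  by have /andP[-> ->] := r01 y; have /andP[_ ->] := r01' y.
have [V yV [K VK]] := rL _ _ Dy; have [V' yV' [K' VK']] := rL' _ _ Dy.
exists (V `&` V'); first exact: filterI.
exists (Num.max K K') => z w [Vz V'z] [Vw V'w]; apply: max_dist.
  by apply: le_trans (VK _ _ Vz Vw) _; rewrite ler_wpM2r // le_max lexx.
by apply: le_trans (VK' _ _ V'z V'w) _; rewrite ler_wpM2r // le_max lexx orbT.
Qed.

(** Compactness of the square of [A]: near the diagonal the local constants apply; near a pair of
    distinct points [rho] varies by at most 1, while injectivity of [phi x] keeps the chart distance
    away from 0. *)
Lemma cutoff_lipschitz rho x (A : set M) : cutoff rho -> closed A ->
  A `<=` D x ->
  \forall K \near +oo, forall y z, A y -> A z ->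
    `|rho y - rho z| <= K * `|phi x y - phi x z|.
Proof.
move=> [r01 rL] clA AD.
pose P (K : R) (q : M * M) :=
  `|rho q.1 - rho q.2| <= K * `|phi x q.1 - phi x q.2|.
have cA : compact A by rewrite -(setTI A); exact: compact_closedI.
have : \forall K \near +oo, A `*` A `<=` P K.
  apply: (compact_near_coveringP _).1; first exact: compact_setX.
  move=> [y z] /= [Ay Az].
  have mono (K K' : R) (q : M * M) : K <= K' -> P K q -> P K' q.
    by move=> KK' PK; apply: le_trans PK _; rewrite ler_wpM2r.
  have [<-{z Az}|yz] := eqVneq y z.
    have [V yV [K VK]] := rL _ _ (AD _ Ay).
    exists (V `*` V, [set K' | K <= K']).
      by split=> /=; [exists (V, V)|apply: nbhs_pinfty_ge; exact: num_real].
    by move=> [[u w] K'] /= [[Vu Vw] KK']; apply: (mono K) => //; exact: VK.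
  have phi_yz : 0 < `|phi x y - phi x z|.
    rewrite normr_gt0 subr_eq0; apply: contra_neq yz => /phi_inj.
    by apply; rewrite inE; exact: AD.
  (* With a quarter of the distance, moving both points by [r] leaves them at least [2 * r] apart,
     so the constant [r^-1] works nearby. *)
  pose r := `|phi x y - phi x z| / 4.
  have r0 : 0 < r by rewrite divr_gt0.
  have near_phi u : A u -> nbhs u [set w | `|phi x u - phi x w| <= r].
    by move=> Au; apply: cvgr_dist_le r0; exact: phi_cont (AD _ Au).
  exists ([set w | `|phi x y - phi x w| <= r] `*`
          [set w | `|phi x z - phi x w| <= r], [set K | r^-1 <= K]).
    split=> /=; last by apply: nbhs_pinfty_ge; exact: num_real.
    exists ([set w | `|phi x y - phi x w| <= r],
            [set w | `|phi x z - phi x w| <= r]) => //=.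
    by split; exact: near_phi.
  move=> [[u w] K] /= [[yu zw] rK]; apply: mono rK _.
  rewrite /P /= mulrC ler_pdivlMr //.
  have : `|phi x y - phi x z| <=
      `|phi x y - phi x u| + `|phi x u - phi x w| + `|phi x z - phi x w|.
    have := ler_normD (phi x y - phi x u) (phi x u - phi x w).
    have := ler_normD (phi x y - phi x w) (phi x w - phi x z).
    by rewrite !subrKA (distrC (phi x w)); lra.
  have rE : `|phi x y - phi x z| = 4 * r by rewrite /r mulrC divfK.
  have : `|rho u - rho w| <= 1.
    by have := r01 u; have := r01 w; rewrite ler_norml;
      move=> /andP[? ?] /andP[? ?]; apply/andP; split; lra.
  nra.
by apply: filterS => K PK y z Ay Az; exact: (PK (y, z)).
Qed.

Context {Z : topologicalType} {E' : normedModType R}.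
Variables (T : set Z) (J : M -> R -> Z).
Hypotheses (hZ : hausdorff_space Z) (cZ : compact [set: Z]).
Hypotheses (hM : hausdorff_space M).
Hypothesis cJ : continuous (fun q : M * R => J q.1 q.2).
Hypothesis Jinj : forall t, injective (J^~ t).
Hypothesis nbhsD : forall x, nbhs x (D x).
Hypothesis cE' : sup_coords E'.
Hypothesis tameJ : forall x t, tame (E' := E') T J x t (phi x).
Hypothesis bump : forall (x : M) (N : set M), nbhs x N ->
  exists2 rho, cutoff rho &
  nbhs x [set y | rho y = 1] /\ forall y, ~ N y -> rho y = 0.

(* The isotopy is switched on one chart at a time: for a list of points x with
   cutoffs rho x, the intermediate stage is taken at the time function
   t0 + (t - t0) max_x (rho x). *)
Lemma ambient_equiv_near (t0 : R) : \forall t \near t0,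
  ambient_equiv T (range (J^~ t0)) (range (J^~ t)).
Proof.
(* The cutoff at [x] is chosen before [rho']. Hence a finite cover by the sets [rho x = 1] can be
   fixed first, and only the range of [t] depends on the part of the list already treated. *)
have step (x : M) : exists rho : M -> R,
    [/\ cutoff rho, nbhs x [set y | rho y = 1] &
    forall rho', cutoff rho' -> \forall t \near t0,
      ambient_equiv T (range (fun y => J y (t0 + (t - t0) * rho' y)))
        (range (fun y => J y (t0 + (t - t0) * Num.max (rho y) (rho' y))))].
  have [A [N [kappa [e [[clA AD xN kappa0 e0] push]]]]] := local_push hZ cZ hM
    cM cJ cE' (tameJ x t0) (nbhsD x) (fun y => @Jinj t0 y x).
  have [rho rhoC [rho1 rho0]] := bump xN.
  exists rho => //; split=> // rho' rhoC'.
  have maxC := cutoff_max rhoC rhoC'.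
  (* One [K] serves both time functions; [t] is then taken so close to [t0] that their Lipschitz
     constant [|t - t0| * K] is below [kappa]. *)
  near (pinfty_nbhs R) => K.
  have K0 : 0 < K by near: K; apply: nbhs_pinfty_gt; exact: num_real.
  have lip (f : M -> R) (t : R) y z : `|t - t0| < kappa / K ->
      `|f y - f z| <= K * `|phi x y - phi x z| ->
      `|t0 + (t - t0) * f y - (t0 + (t - t0) * f z)|
        <= kappa * `|phi x y - phi x z|.
    move=> tk fK; rewrite opprD addrACA subrr add0r -mulrBr normrM.
    rewrite (le_trans (ler_wpM2l _ fK)) // mulrA ler_wpM2r //.
    by rewrite -ler_pdivlMr // ltW.
  have dist (f : M -> R) (t : R) y : 0 <= f y <= 1 -> `|t - t0| < e ->
      `|t0 + (t - t0) * f y - t0| < e.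
    move=> /andP[f0 f1] te; rewrite addrAC subrr add0r normrM (ger0_norm f0).
    by rewrite (le_lt_trans _ te) // ler_piMr.
  have KL : forall y z, A y -> A z ->
      `|rho' y - rho' z| <= K * `|phi x y - phi x z|.
    by near: K; exact: cutoff_lipschitz.
  have KLm : forall y z, A y -> A z ->
      `|Num.max (rho y) (rho' y) - Num.max (rho z) (rho' z)|
      <= K * `|phi x y - phi x z|.
    by near: K; exact: cutoff_lipschitz maxC clA AD.
  have nt r : 0 < r -> \forall t \near t0, `|t - t0| < r.
    move=> r0; apply: filterS (nbhsx_ballx t0 r r0) => t.
    by rewrite -ball_normE /= distrC.
  near=> t.
  have te : `|t - t0| < e by near: t; exact: nt.
  have tk : `|t - t0| < kappa / K by near: t; apply: nt; exact: divr_gt0.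
  apply: push.
  - by move=> y; apply: dist => //; exact: rhoC'.1.
  - move=> y; apply: (dist (fun y => Num.max (rho y) (rho' y))) => //.
    exact: maxC.1.
  - move=> y /rho0 ->; congr (_ + _ * _); apply/esym/max_idPr.
    by have /andP[] := rhoC'.1 y.
  - by move=> y z Ay Az; apply: lip => //; exact: KL.
  - move=> y z Ay Az.
    by apply: (lip (fun y => Num.max (rho y) (rho' y))) => //; exact: KLm.
have /choice[rho rhoP] := step.
have [s sP] : exists s : seq M, forall y, exists2 x, x \in s & rho x y = 1.
  apply: (compact_finite_cover (B := fun x => [set y | rho x y = 1])) => // x.
  by have [] := rhoP x.
pose P (s : seq M) y := \big[Num.max/0]_(x <- s) rho x y.
have PC (u : seq M) : cutoff (P u).
  elim: u => [|x u ih].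
    rewrite (_ : P [::] = cst 0); first exact: cutoff0.
    by apply/funext => y; rewrite /P big_nil.
  rewrite (_ : P (x :: u) = fun y => Num.max (rho x y) (P u y)).
    by apply: cutoff_max => //; have [] := rhoP x.
  by apply/funext => y; rewrite /P big_cons.
have PE (u : seq M) : \forall t \near t0, ambient_equiv T (range (J^~ t0))
    (range (fun y => J y (t0 + (t - t0) * P u y))).
  elim: u => [|x u ih].
    near=> t; rewrite (_ : (fun y => J y _) = J^~ t0).
      exact: ambient_equiv_refl.
    by apply/funext => y; rewrite /P big_nil mulr0 addr0.
  have [_ _ /(_ _ (PC u)) H] := rhoP x.
  near=> t.
  rewrite (_ : (fun y => J y (t0 + (t - t0) * P (x :: u) y)) =
    fun y => J y (t0 + (t - t0) * Num.max (rho x y) (P u y))); last first.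
    by apply/funext => y; rewrite /P big_cons.
  apply: (ambient_equiv_trans
    (B := range (fun y => J y (t0 + (t - t0) * P u y)))); near: t;
    [exact: ih|exact: H].
apply: filterS (PE s) => t.
suff -> : (fun y => J y (t0 + (t - t0) * P s y)) = J^~ t by [].
apply/funext => y; rewrite (_ : P s y = 1) ?mulr1 ?subrKC //.
have [x xs xy1] := sP y; apply/le_anti.
have [/(_ y)/andP[_ ->] _] := PC s.
by rewrite -xy1 /P (perm_big _ (perm_to_rem xs)) big_cons le_max lexx.
Unshelve. all: by end_near. Qed.

Lemma isotopy_ambient_equiv (t0 t : R) :
  ambient_equiv T (range (J^~ t0)) (range (J^~ t)).
Proof.
apply: (locally_constant_real
  (P := fun s t => ambient_equiv T (range (J^~ s)) (range (J^~ t)))).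
- by move=> ? ?; exact: ambient_equiv_sym.
- by move=> ? ? ?; exact: ambient_equiv_trans.
- exact: ambient_equiv_near.
Qed.

End IsotopyPush.

(** * Charts and local representatives *)

Section Charts.
Context {R : realType}.

Lemma set_type_continuous (X Y : topologicalType) (A : set X) (f : Y -> A) y :
  {for y, continuous (fun y => set_val (f y))} -> {for y, continuous f}.
Proof.
move=> cf U /= [_ [/= [V oV <-]] Vfy VU].
have yV : nbhs (set_val (f y)) V by exact: open_nbhs_nbhs.
have : nbhs y ((fun y => set_val (f y)) @^-1` V) by exact: cf.
by apply: filterS => z /VU.
Qed.

(* Written with maxima only, so that max_dist gives the Lipschitz bound. *)
Definition clampR (t : R) : R := Num.max 0 (1 - Num.max 0 (1 - t)).

Lemma clampR_itv t : clampR t \in [set` `[0 : R, 1]].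
Proof.
rewrite mem_setE in_itv /= /clampR le_max lexx /= ge_max ler01 /=.
by rewrite gerBl le_max lexx.
Qed.

Definition clampI (t : R) : unitI R := exist _ (clampR t) (clampR_itv t).

Lemma clampR_id (t : R) : 0 <= t <= 1 -> clampR t = t.
Proof.
move=> /andP[t0 t1]; rewrite /clampR (@max_r _ _ 0 (1 - t)) ?subr_ge0 // subKr.
exact: max_r.
Qed.

Lemma unitI_itv (t : unitI R) : 0 <= (set_val t : R) <= 1.
Proof. by have := set_valP t; rewrite /= in_itv. Qed.

Lemma clampI_id (t : unitI R) : clampI (set_val t) = t.
Proof. by apply: val_inj => /=; exact/clampR_id/unitI_itv. Qed.

Lemma clampR_dist (s t : R) : `|clampR s - clampR t| <= `|s - t|.
Proof.
rewrite /clampR; apply: max_dist; first by rewrite subrr normr0.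
rewrite opprD addrACA subrr add0r -opprD normrN; apply: max_dist.
  by rewrite subrr normr0.
by rewrite opprD addrACA subrr add0r -opprD normrN.
Qed.

Lemma clampI_continuous : continuous clampI.
Proof.
move=> t; apply: set_type_continuous => /=.
apply: (@lipschitz_continuous R R^o 1 R^o clampR) => x y.
by rewrite mul1r clampR_dist.
Qed.

(** A relatively open subset of [C] becomes open in [E] once intersected with the interior of [C],
    so it is enough to restrict the domain to points with interior values. *)
Lemma chart_into_euclidean (T E : topologicalType) (C : set E) (c : chart T E) :
  chart_into C c -> euclidean_chart (chart_dom c `&` c @^-1` C°) c.
Proof.
move=> [oc cc ic op].
have ccx z : chart_dom c z -> {for z, continuous c}.
  by move=> cz; move: cc; rewrite continuous_open_subspace // => /(_ z); apply;
    rewrite inE.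
have oD : open (chart_dom c `&` c @^-1` C°).
  rewrite openE => z [cz Cz]; apply: filterI; first exact: open_nbhs_nbhs.
  by apply: (ccx z cz); apply: open_nbhs_nbhs; split=> //; exact: open_interior.
split=> //; first by move=> z [cz _]; exact: ccx.
  by move=> y z; rewrite !inE => -[cy _] [cz _]; apply: ic; rewrite inE.
move=> z U Dz zU.
have [W [oW Wz] WU] : exists2 W, open_nbhs z W & W `<=` U `&` chart_dom c.
  have : nbhs z (U `&` chart_dom c).
    by apply: filterI => //; apply: open_nbhs_nbhs; split=> //; case: Dz.
  by rewrite nbhsE => -[W zW WU]; exists W.
have [V oV cWE] := op W oW (fun w Ww => (WU w Ww).2).
have [CVz Vz] : (C `&` V) (c z) by rewrite -cWE; exists z.
have : nbhs (c z) (C° `&` V).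
  apply: open_nbhs_nbhs; split.
    by apply: openI => //; exact: open_interior.
  by split => //; case: Dz.
apply: filterS => v [/interior_subset Cv Vv].
have [w Ww <-] : (c @` W) v by rewrite cWE.
by exists w => //; exact: (WU w Ww).1.
Qed.

Lemma pair_continuous (S T T' : topologicalType) (f : S -> T) (g : S -> T') x :
  {for x, continuous f} -> {for x, continuous g} ->
  {for x, continuous (fun x => (f x, g x))}.
Proof. by move=> cf cg; apply: cvg_pair; [exact: cf|exact: cg]. Qed.

Lemma map_pair_continuous (T T' E E' : topologicalType) (f : T -> E)
    (g : T' -> E') x y : {for x, continuous f} -> {for y, continuous g} ->
  {for (x, y), continuous (fun p => (f p.1, g p.2))}.
Proof.
move=> cf cg; apply: pair_continuous.
  by apply: (continuous_comp (f := fst)); [exact: cvg_fst|exact: cf].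
by apply: (continuous_comp (f := snd)); [exact: cvg_snd|exact: cg].
Qed.

Lemma euclidean_chart_prod (T T' E E' : topologicalType) (O : set T)
    (O' : set T') (c : T -> E) (c' : T' -> E') :
  euclidean_chart O c -> euclidean_chart O' c' ->
  euclidean_chart (O `*` O') (fun p => (c p.1, c' p.2)).
Proof.
move=> [oO cc ic op] [oO' cc' ic' op']; split.
- by rewrite openE => -[x y] [/= Ox Oy]; exists (O, O') => //; split;
    exact: open_nbhs_nbhs.
- move=> [x y] [/= Ox Oy].
  by apply: map_pair_continuous; [exact: cc|exact: cc'].
- move=> [x y] [x' y']; rewrite !inE => -[/= Ox Oy] [/= Ox' Oy'] [xx yy].
  by congr pair; [apply: ic|apply: ic']; rewrite ?inE.
- move=> [x y] U [/= Ox Oy] [[A B] /= [xA yB] ABU].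
  exists (c @` A, c' @` B); first by split; [exact: op|exact: op'].
  by move=> [_ _] [[/= a Aa <-] [b Bb <-]]; exists (a, b) => //; exact: ABU.
Qed.

Lemma interior_setX (E E' : topologicalType) (A : set E) (B : set E') p :
  (A `*` B)° p -> A° p.1 /\ B° p.2.
Proof.
move=> [[U V] /= [pU pV] UVAB].
split; [apply: filterS pU => u Uu|apply: filterS pV => v Vv].
  by have [] := UVAB (u, p.2) (conj Uu (nbhs_singleton pV)).
by have [] := UVAB (p.1, v) (conj (nbhs_singleton pU) Vv).
Qed.

Lemma unitI_chart_into : chart_into ([set` `[0, 1]] : set R^o)
  (Chart setT (fun t : unitI R => set_val t : R^o)).
Proof.
split => /=.
- exact: openT.
- by apply: continuous_subspaceT; exact: initial_continuous.
- by move=> x y _ _; exact: val_inj.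
- move=> W [V oV <-] _; exists V => //; apply/seteqP; split.
    by move=> _ [t Vt <-]; split=> //; exact: set_valP.
  by move=> t [/mem_set t01 Vt]; exists (exist _ t t01).
Qed.

Lemma interior_itv01_neq1 (t : R^o) : ([set` `[0, 1]] : set R^o)° t -> t != 1.
Proof.
move=> /nbhs_ballP[e /= e0 eI]; apply/eqP => t1.
have /eI : ball t e (t + e / 2).
  rewrite -ball_normE /= opprD addrA subrr add0r normrN gtr0_norm ?divr_gt0 //.
  by rewrite ltr_pdivrMr // ltr_pMr // ltr1n.
by rewrite /= in_itv /= t1 gerDl (leNgt (e / 2)) divr_gt0 // andbF.
Qed.

Lemma local_rep_strict (E E' : normedModType R) (cE : sup_coords E)
    (cE' : sup_coords E') (T T' : topologicalType) (c : chart T E)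
    (c' : chart T' E') (f : T -> T') x g (eta : R) :
  local_rep c c' f x g -> 0 < eta -> {for x, continuous c} ->
  nbhs x (chart_dom c) -> nbhs x (f @^-1` chart_dom c') ->
  exists2 V, nbhs x V & forall z w, V z -> V w ->
    `|c' (f z) - c' (f w) - 'd g (c x) (c z - c w)| <= eta * `|c z - c w|.
Proof.
move=> [W [oW Wx sg gE]] eta0 cx xc xc'.
have [r r0 gr] := strict_differentiability cE cE' oW Wx (sg 1) eta0.
have xr : nbhs x (c @^-1` ball (c x) r) by apply: cx; exact: nbhsx_ballx.
have xW : nbhs x (c @^-1` W) by apply: cx; exact: open_nbhs_nbhs.
exists ((chart_dom c `&` f @^-1` chart_dom c') `&`
        (c @^-1` ball (c x) r `&` c @^-1` W)).
  by apply: filterI; exact: filterI.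
move=> z w [[cz c'z] [rz Wz]] [[cw c'w] [rw Ww]].
by rewrite -gE // -gE //; exact: gr.
Qed.

Lemma local_rep_diff_continuous (E E' : normedModType R)
    (T T' : topologicalType) (c : chart T E)
    (c' : chart T' E') (f : T -> T') x g :
  local_rep c c' f x g -> continuous ('d g (c x)).
Proof.
move=> [W [_ Wx sg _]]; apply: diff_continuous.
by have [dg _] := sg 1; exact: dg.
Qed.

(** The constant is the minimum of the norm of [L v] over the unit sphere, which is compact; it is
    positive by injectivity. *)
Lemma injective_linear_bounded_below n (E' : normedModType R)
    (L : {linear 'rV[R]_n -> E'}) :
  continuous L -> injective L ->
  exists2 m : R, 0 < m & forall v, m * `|v| <= `|L v|.
Proof.
move=> cL iL.
pose S : set 'rV[R]_n := [set v | `|v| = 1].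
(* The sphere is empty when [n = 0]; then every [v] is 0 and any constant works. *)
have [[v0 Sv0]|S0] := pselect (S !=set0); last first.
  exists 1 => // v; have [->|v0] := eqVneq v 0.
    by rewrite normr0 mulr0.
  exfalso; apply: S0; exists (`|v|^-1 *: v).
  by rewrite /S /= normrZ normfV normr_id mulVf // normr_eq0.
have cS : compact S.
  apply: bounded_closed_compact.
    by exists 1; split=> // M M1 v /= ->; exact: ltW.
  have -> : S = (fun v : 'rV[R]_n => `|v|) @^-1` [set 1] by [].
  apply: closed_comp; last exact: closed_eq.
  by move=> v _; exact: norm_continuous.
have [|v /[!inE] Sv vmin] := compact_EVT_min (f := fun v => `|L v| : R)
    (ex_intro _ v0 Sv0) cS.
  apply: continuous_subspaceT => v.
  by apply: continuous_comp; [exact: cL|exact: norm_continuous].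
have v_neq0 : v != 0 by rewrite -normr_eq0 Sv oner_eq0.
exists `|L v|.
  rewrite normr_gt0; apply: contra_neq v_neq0 => Lv.
  by apply: iL; rewrite linear0.
move=> w; have [->|w0] := eqVneq w 0; first by rewrite normr0 mulr0.
have : `|L v| <= `|L (`|w|^-1 *: w)|.
  by apply: vmin; rewrite inE /S /= normrZ normfV normr_id mulVf // normr_eq0.
by rewrite linearZ normrZ normfV normr_id ler_pdivlMl ?normr_gt0 // mulrC.
Qed.

End Charts.

Section ClosedManifold.
Context {R : realType} {n : nat} (M : closed_manifold R n).

Lemma closed_manifold_euclidean c :
  atlas M c -> euclidean_chart (chart_dom c) c.
Proof.
have [_ _ ci _ _] := clm_manifold M => /ci/chart_into_euclidean.
by rewrite interiorT preimage_setT setIT.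
Qed.

(** Strict differentiability with error 1 bounds the transition map by a Lipschitz constant of its
    differential plus 1. Through this a bump built in one chart is Lipschitz in the others. *)
Lemma transition_lipschitz (c c' : chart M 'rV[R]_n) (x : M) :
  atlas M c -> atlas M c' -> chart_dom c x -> chart_dom c' x ->
  exists2 V, nbhs x V & exists2 K, 0 <= K & forall z w, V z -> V w ->
    `|c' z - c' w| <= K * `|c z - c w|.
Proof.
move=> ac ac' cx c'x.
have [_ _ _ _ /(_ c c' ac ac' x cx c'x)[g gE]] := clm_manifold M.
have [oc cc _ _] := closed_manifold_euclidean ac.
have [oc' _ _ _] := closed_manifold_euclidean ac'.
have [V xV Vlip] := local_rep_strict (rV_coords n) (rV_coords n) gE ltr01
  (cc x cx) (open_nbhs_nbhs (conj oc cx)) (open_nbhs_nbhs (conj oc' c'x)).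
have [k k0 gk] := linear_lipschitz (local_rep_diff_continuous gE).
exists V => //; exists (k + 1); first by rewrite addr_ge0 // ltW.
move=> z w Vz Vw; have := Vlip z w Vz Vw; have := gk (c z - c w).
rewrite mul1r mulrDl mul1r => H1 H2.
rewrite -(subrK ('d g (c x) (c z - c w)) (c' z - c' w)) [leRHS]addrC.
exact: le_trans (ler_normD _ _) (lerD H2 H1).
Qed.

Variable phi : M -> chart M 'rV[R]_n.
Hypotheses (phi_atlas : forall x, atlas M (phi x))
           (phi_dom : forall x, chart_dom (phi x) x).

Lemma chart_bump (x : M) (N : set M) : nbhs x N ->
  exists2 rho : M -> R, cutoff phi (fun x => chart_dom (phi x)) rho &
    nbhs x [set y | rho y = 1] /\ forall y, ~ N y -> rho y = 0.
Proof.
move=> xN; have [hM _ _ _ _] := clm_manifold M.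
pose c := phi x.
have [oc cc ic op] := closed_manifold_euclidean (phi_atlas x).
have xc : nbhs x (chart_dom c).
  by apply: open_nbhs_nbhs; split=> //; exact: phi_dom.
have [B xB clB] := compact_closure_subset hM (@clm_compact _ _ M)
  (filterI xN xc).
have /nbhs_ballP[r /= r0 rB] := op _ _ (phi_dom x) xB.
(* [u] is at most 0 within [r / 2] of [c x] and at least 1 beyond [r], so [h] is 1 on the smaller
   ball and 0 off the larger one. *)
pose u y := 2 / r * `|c y - c x| - 1.
pose h y : R := Num.max 0 (1 - Num.max 0 (u y)).
(* The values of [c] outside its domain are arbitrary, hence the case distinction. The closure of
   [B] lies in the domain, so [rho] vanishes near every point outside it. *)
pose rho y : R := if pselect (chart_dom c y) then h y else 0.
have h01 y : 0 <= h y <= 1.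
  by rewrite /h le_max lexx ge_max ler01 gerBl le_max lexx.
have rhoB y : ~ B y -> rho y = 0.
  move=> nBy; rewrite /rho; case: pselect => // cy.
  apply/max_idPl; rewrite subr_le0 le_max; apply/orP; right.
  rewrite /u lerBrDr; have : ~ ball (c x) r (c y).
    by move=> /rB[b Bb]/ic H; apply: nBy; rewrite -H ?inE //;
      have [] := clB _ (subset_closure Bb).
  rewrite -ball_normE /= distrC => /negP; rewrite -leNgt => H.
  have : 2 / r * r <= 2 / r * `|c y - c x|.
    by rewrite ler_wpM2l // divr_ge0 // ltW.
  by rewrite divfK ?gt_eqF.
exists rho.
  split=> [y|x' y Dy].
    by rewrite /rho; case: pselect => [?|?]; [exact: h01|rewrite lexx ler01].
  have [cy|ncy] := pselect (chart_dom c y).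
    have [V yV [K K0 Vlip]] :=
      transition_lipschitz (phi_atlas x') (phi_atlas x) Dy cy.
    exists (V `&` chart_dom c).
      by apply: filterI => //; exact: open_nbhs_nbhs.
    exists (2 / r * K) => z w [Vz cz] [Vw cw]; rewrite /rho.
    case: pselect => // ?; case: pselect => // ?.
    have H0 : 0 <= 2 / r * K * `|phi x' z - phi x' w|.
      by rewrite !mulr_ge0 // invr_ge0 ltW.
    apply: max_dist; first by rewrite subrr normr0.
    rewrite opprD addrACA subrr add0r -opprD normrN.
    apply: max_dist; first by rewrite subrr normr0.
    rewrite /u opprB addrA subrK -mulrBr normrM gtr0_norm ?divr_gt0 //.
    rewrite -(mulrA (2 / r)).
    apply: ler_wpM2l; first by rewrite divr_ge0 // ltW.
    rewrite (le_trans (ler_dist_dist _ _)) //.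
    by rewrite opprB addrA subrK; exact: Vlip.
  exists (~` B).
    rewrite -[nbhs y _]/((~` B)^° y) interiorC => /clB[_].
    exact: ncy.
  by exists 0 => z w Bz Bw; rewrite !rhoB // subrr normr0 mul0r.
split; last first.
  move=> y nNy; apply: rhoB => By.
  by apply: nNy; have [] := clB _ (subset_closure By).
have xr : nbhs x (c @^-1` ball (c x) (r / 2)).
  by apply: (cc x (phi_dom x)); apply: nbhsx_ballx; rewrite divr_gt0.
apply: filterS (filterI xc xr) => y [cy]; rewrite -ball_normE /= distrC => cyr.
rewrite /rho; case: pselect => // ?; rewrite /h (_ : Num.max 0 (u y) = 0).
  by rewrite subr0; apply/max_idPr.
apply/max_idPl; rewrite /u subr_le0 mulrC -ler_pdivlMr ?divr_gt0 //.
by rewrite mul1r invf_div ltW.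
Qed.
End ClosedManifold.

(** * Isotopies of links *)

Section Isotopy.
Context {R : realType} {n : nat}.

Definition cylinder_coords (m : nat) : sup_coords ('rV[R]_m * R^o)%type :=
  prod_coords (rV_coords m) Ro_coords.

Definition cylinder_top (F : compact_manifold R n) : set (cylinder F) :=
  [set p | p.2 = unitI1].
Arguments cylinder_top : clear implicits.

(** Restricting to values in the interior of the model set removes boundary and corners; in the
    interval coordinate it also excludes 1, so a push supported in [O] fixes the top. *)
Lemma cylinder_interior_chart (F : compact_manifold R n) (p : cylinder F) :
  manifold_interior (cylinder F) p ->
  exists2 d, atlas (cylinder F) d & exists O : set (cylinder F),
    [/\ euclidean_chart O d, O p, O `<=` chart_dom d &
        O `&` cylinder_top F = set0].
Proof.
move=> [_ [d1 [d2 [ad1 ad2 ->]]] [[d1p d2p] /interior_setX[/= i1 i2]]].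
exists (prod_chart d1 d2); first by exists d1, d2.
have [_ _ ci _ _] := cm_manifold F.
have e1 := chart_into_euclidean (ci _ ad1).
have e2 := chart_into_euclidean (@unitI_chart_into R).
rewrite -ad2 in e2.
exists ((chart_dom d1 `&` d1 @^-1` (@half_space R n)°) `*`
  (chart_dom d2 `&` d2 @^-1` ([set` `[0, 1]] : set R^o)°)); split.
- exact: euclidean_chart_prod.
- by [].
- by move=> [x t] [[/= ? _] [? _]].
- apply/seteqP; split=> // -[x t] [[/= _ [_ it]]] t1.
  have {}t1 : t = unitI1 := t1.
  move: it; rewrite t1 ad2 /= => /interior_itv01_neq1.
  by rewrite set_valE /= eqxx.
Qed.

Lemma cluster_image (X Y : topologicalType) (f : X -> Y) (p q : X) :
  hausdorff_space Y -> continuous f -> cluster (nbhs p) q -> f p = f q.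
Proof.
move=> hY cf clpq; apply: hY => A B pA qB.
have [z [Az Bz]] := clpq _ _ (cf p A pA) (cf q B qB).
by exists (f z).
Qed.

Lemma unitI_hausdorff : hausdorff_space (unitI R).
Proof.
move=> s t st; apply: val_inj.
exact: (cluster_image (@norm_hausdorff _ R)
  (@initial_continuous _ _ set_val) st).
Qed.

Lemma unitI_compact : compact [set: unitI R].
Proof.
have -> : [set: unitI R] = clampI @` `[0, 1].
  apply/seteqP; split=> // t _; exists (set_val t); first exact: set_valP.
  exact: clampI_id.
apply: continuous_compact; last exact: segment_compact.
by apply: continuous_subspaceT; exact: clampI_continuous.
Qed.

Lemma cylinder_hausdorff (F : compact_manifold R n) :
  hausdorff_space (cylinder F).
Proof.
have [hF _ _ _ _] := cm_manifold F.
move=> [x s] [y t] pq; congr pair.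
  apply: (cluster_image (f := fun p : cylinder F => p.1) hF _ pq).
  by move=> ?; exact: cvg_fst.
apply: (cluster_image (f := fun p : cylinder F => p.2) unitI_hausdorff _ pq).
by move=> ?; exact: cvg_snd.
Qed.

Lemma cylinder_compact (F : compact_manifold R n) : compact [set: cylinder F].
Proof.
have -> : [set: cylinder F] = [set: F] `*` [set: unitI R].
  by apply/seteqP; split.
by apply: compact_setX; [exact: cm_compact|exact: unitI_compact].
Qed.

Variables (F : compact_manifold R n) (M : closed_manifold R n).
Variable J : cylinder M -> cylinder F.
Hypothesis smJ : smooth_map J.
Hypothesis embJ : forall t : unitI R,
  smooth_embedding (fun x : M => J (x, t)) /\
  range (fun x : M => J (x, t)) `<=` manifold_interior (cylinder F).

(** One differential ['d g] of the joint map at [(x, tt)] controls all nearby stages and gives the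
    two upper bounds. The lower bound comes from immersivity of the stage at [t0], which has its own
    representative [g']; the two are compared through their estimates at [t0], not as linear
    maps. *)
Lemma isotopy_tame (c : chart M 'rV[R]_n) (x : M) (t0 : R) :
  atlas M c -> chart_dom c x ->
  tame (E' := ('rV[R]_n.+1 * R^o)%type) (cylinder_top F)
    (fun y t => J (y, clampI t)) x t0 c.
Proof.
move=> ac cx; set tt := clampI t0.
have [[_ immJ _] intJ] := embJ tt.
have [d ad [ O [dO Op Od OT]]] := cylinder_interior_chart
  (intJ (J (x, tt)) (ex_intro2 _ _ x I erefl)).
have [oO dc _ _] := dO.
have [oc cc _ _] := closed_manifold_euclidean ac.
pose I01 := Chart setT (fun t : unitI R => set_val t : R^o).
have acI : atlas (cylinder M) (prod_chart c I01) by exists c, I01.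
have Jc : continuous J by have [] := smJ.
have [g gE] := smJ.2 _ _ acI ad (x, tt) (conj cx I) (Od _ Op).
have [g' g'E g'inj] := immJ _ _ ac ad x cx (Od _ Op).
have [m0 m0_gt0 g'm0] :=
  injective_linear_bounded_below (local_rep_diff_continuous g'E) g'inj.
have [k k_gt0 gk] := linear_lipschitz (local_rep_diff_continuous gE).
have xO : nbhs (x, tt) (J @^-1` O) by apply: Jc; exact: open_nbhs_nbhs.
have cIc : {for (x, tt), continuous (prod_chart c I01)}.
  apply: (map_pair_continuous (f := c)
    (g := fun t : unitI R => set_val t : R^o)).
    exact: cc.
  exact: initial_continuous.
have xcI : nbhs (x, tt) (chart_dom (prod_chart c I01)).
  exists (chart_dom c, setT); last by move=> [? ?] [? _].
  by split; [apply: open_nbhs_nbhs|exact: filterT].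
have xd : nbhs (x, tt) (J @^-1` chart_dom d) by apply: filterS xO => ? /Od.
(* With [m = m0 / 4] the last bound of [tame] allows [m / 8 = m0 / 32], that is, two errors of
   [m0 / 64]. *)
have eta0 : 0 < m0 / 64 by rewrite divr_gt0.
have [V xV Vg] := local_rep_strict (cylinder_coords n) (cylinder_coords n.+1) gE
  eta0 cIc xcI xd.
have xO' : nbhs x ((fun y => J (y, tt)) @^-1` chart_dom d).
  have [[A B] /= [xA tB] AB] := xO.
  apply: filterS xA => y Ay; apply/Od/(AB (y, tt)); split=> //=.
  exact: nbhs_singleton.
have eta'0 : 0 < m0 / 2 by rewrite divr_gt0.
have [V' xV' Vg'] := local_rep_strict (rV_coords n) (cylinder_coords n.+1) g'E
  eta'0 (cc _ cx) (open_nbhs_nbhs (conj oc cx)) xO'.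
have [[N U] /= [xN tU] NU] := filterI xV xO.
exists O, d, (m0 / 4), (k + m0 / 64); split.
  by split=> //; [rewrite divr_gt0|rewrite addr_ge0 // ltW // divr_gt0].
have /nbhs_ballP[e /= e0 eU] : nbhs t0 (clampI @^-1` U).
  exact: clampI_continuous.
exists (N `&` V'), e; split=> //; first exact: filterI.
move=> t s te se y z [Ny V'y] [Nz V'z].
have inU r : `|r - t0| < e -> U (clampI r).
  by move=> re; apply: eU; rewrite -ball_normE /= distrC.
have NV y' r : N y' -> `|r - t0| < e ->
    V (y', clampI r) /\ O (J (y', clampI r)).
  by move=> Ny' /inU Ur; exact: (NU (y', clampI r)).
have Utt : `|t0 - t0| < e by rewrite subrr normr0.
(* The differential is applied to the same vector [(c y - c z, 0)] at every time [r], so it cancels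
   between two stages. *)
have space r : `|r - t0| < e -> `|(d (J (y, clampI r)) - d (J (z, clampI r))) -
    'd g (c x, set_val tt) (c y - c z, 0)| <= m0 / 64 * `|c y - c z|.
  move=> re; have [Vy _] := NV _ _ Ny re; have [Vz _] := NV _ _ Nz re.
  have := Vg _ _ Vy Vz.
  rewrite [X in 'd _ _ X](_ : _ = (c y - c z, 0)); last first.
    by congr pair; rewrite /= subrr.
  rewrite [X in _ * X](_ : _ = `|c y - c z|) //.
  rewrite prod_normE /= subrr normr0; exact: max_l.
split; first exact: (NV _ _ Ny te).2.
(* The norm of [P] is at least [m0 - m0 / 2 - 2 * (m0 / 64)] times the chart distance, which exceeds
   the required factor [m0 / 4]. *)
- have dyz := space _ te; have dyz0 := space _ Utt; rewrite -/tt in dyz0.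
  have Lyz := Vg' _ _ V'y V'z; have lb := g'm0 (c y - c z).
  set D := 'd g _ _ in dyz dyz0; set D' := 'd g' _ _ in Lyz lb.
  set P := d _ - d _ in dyz *; set P0 := d _ - d _ in dyz0 Lyz.
  have h2 : `|D'| <= `|P0| + `|P0 - D'|.
    by have := ler_normB P0 (P0 - D'); rewrite subKr.
  have h3 : `|P0| <= `|P| + (`|P - D| + `|P0 - D|).
    have := ler_normB P (P - P0); rewrite subKr => H.
    have : `|P - P0| <= `|P - D| + `|P0 - D|.
      by rewrite (distrC P0) -(subrKA D P (- P0)) ler_normD.
    lra.
  have : 0 <= m0 * `|c y - c z| by rewrite mulr_ge0 // ltW.
  lra.
- have [Vyt _] := NV _ _ Ny te; have [Vys _] := NV _ _ Ny se.
  have := Vg _ _ Vyt Vys.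
  rewrite [X in 'd _ _ X](_ : _ = (0, (clampR t - clampR s : R^o))); last first.
    by congr pair; rewrite /= subrr.
  rewrite [X in _ * X](_ : _ = `|clampR t - clampR s|); last first.
    by rewrite prod_normE /= subrr normr0; exact: max_r.
  have := gk (0, (clampR t - clampR s : R^o)).
  rewrite [X in k * X](_ : _ = `|clampR t - clampR s|); last first.
    by rewrite prod_normE /= normr0; exact: max_r.
  set D := 'd g _ _; set P := d _ - d _ => h1 h2.
  have := clampR_dist t s; have := ler_normD (P - D) D; rewrite subrK.
  have : 0 < k + m0 / 64 by rewrite addr_gt0 // divr_gt0.
  move=> h3 h4 /(ler_wpM2l (ltW h3)); rewrite mulrDl.
  lra.
- have dt := space _ te; have ds := space _ se.
  set D := 'd g _ _ in dt ds.
  set P := d _ - d _ in dt *; set Q := d _ - d _ in ds *.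
  have : `|P - Q| <= `|P - D| + `|Q - D|.
    by rewrite (distrC Q) -(subrKA D P (- Q)) ler_normD.
  lra.
Qed.

Lemma isotopy_stages_ambient_equiv :
  ambient_equiv (cylinder_top F) (range (fun x : M => J (x, unitI0)))
    (range (fun x : M => J (x, unitI1))).
Proof.
have [hM _ _ chM _] := clm_manifold M.
have /choice[phi phiP] (x : M) : exists c, atlas M c /\ chart_dom c x.
  by have [c ac cx] := chM x; exists c.
have phi_atlas x : atlas M (phi x) := (phiP x).1.
have phi_dom x : chart_dom (phi x) x := (phiP x).2.
have euc x := closed_manifold_euclidean (phi_atlas x).
have unitIE (t : unitI R) : t = clampI (set_val t) by rewrite clampI_id.
rewrite (unitIE unitI0) (unitIE unitI1).
apply: (@isotopy_ambient_equiv R M _ phi (fun x => chart_dom (phi x)) _ _ _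
  (cylinder F) ('rV[R]_n.+1 * R^o)%type _ (fun y t => J (y, clampI t))).
- exact: clm_compact.
- by move=> x y xy; have [_ cc _ _] := euc x; exact: cc.
- by move=> x; have [_ _ ic _] := euc x.
- exact: cylinder_hausdorff.
- exact: cylinder_compact.
- exact: hM.
- move=> [x t].
  apply: (continuous_comp (f := fun q => (q.1, clampI q.2)) (g := J)).
    apply: (map_pair_continuous (f := id)); first exact: cvg_id.
    exact: clampI_continuous.
  by have [cJ _] := smJ; exact: cJ.
- by move=> t; have [[_ _ [_ iJ _]] _] := embJ (clampI t); exact: iJ.
- by move=> x; have [oD _ _ _] := euc x; apply: open_nbhs_nbhs.
- exact: cylinder_coords.
- by move=> x t; apply: isotopy_tame.
- by move=> x N; exact: chart_bump.
Qed.

End Isotopy.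

Lemma isotopic_ambient_equiv (R : realType) (n : nat) (F : compact_manifold R n)
    (L L' : set (cylinder F)) :
  isotopic L L' -> ambient_equiv (@cylinder_top R n F) L L'.
Proof.
by move=> [M [J [smJ embJ <- <-]]]; exact: isotopy_stages_ambient_equiv.
Qed.

(** * Homotopy equivalences of pairs and of cones *)

Section Homotopy.
Context {R : realType}.

Lemma continuous_either (X Y : topologicalType) (f g h : X -> Y) p :
  {for p, continuous f} -> {for p, continuous g} -> h p = f p -> h p = g p ->
  (forall z, h z = f z \/ h z = g z) -> {for p, continuous h}.
Proof.
move=> cf cg hf hg hfg U hU.
have fU : nbhs p (f @^-1` U) by apply: cf; rewrite -hf.
have gU : nbhs p (g @^-1` U) by apply: cg; rewrite -hg.
by apply: filterS (filterI fU gU) => z [/= Uf Ug]; case: (hfg z) => ->.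
Qed.

Lemma continuous_near_eq (X Y : topologicalType) (f h : X -> Y) p :
  {for p, continuous f} -> (\forall z \near p, h z = f z) ->
  {for p, continuous h}.
Proof.
move=> cf hf U hU.
have fU : nbhs p (f @^-1` U) by apply: cf; rewrite -(nbhs_singleton hf).
by apply: filterS (filterI fU hf) => z [/= Uf ->].
Qed.

Lemma homotopic_trans (X Y : topologicalType) (f g h : X -> Y) :
  homotopic R f g -> homotopic R g h -> homotopic R f h.
Proof.
move=> [H [cH H0 H1]] [K [cK K0 K1]].
(* Clamping makes both halves continuous at all times, each being constant beyond its own half; they
   agree where the doubled time is 1. *)
pose F (p : X * unitI R) := H (p.1, clampI (2 * set_val p.2)).
pose G (p : X * unitI R) := K (p.1, clampI (2 * set_val p.2 - 1)).
have cX (a b : R) :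
    continuous (fun p : X * unitI R => (p.1, clampI (a * set_val p.2 + b))).
  move=> [x t]; apply: (map_pair_continuous (f := id)
    (g := fun t : unitI R => clampI (a * set_val t + b))).
    exact: cvg_id.
  apply: (continuous_comp (f := fun t : unitI R => a * set_val t + b)).
    apply: (continuous_comp (f := set_val) (g := fun r : R => a * r + b)).
      exact: initial_continuous.
    apply: (@continuousD _ R^o); last exact: cst_continuous.
    exact: mulrl_continuous.
  exact: clampI_continuous.
have cF : continuous F.
  move=> p; rewrite (_ : F = H \o
    fun p : X * unitI R => (p.1, clampI (2 * set_val p.2 + 0))); last first.
    by apply/funext => q; rewrite /F /= addr0.
  by apply: continuous_comp; [exact: cX|exact: cH].
have cG : continuous G.
  by move=> p; apply: (continuous_comp
    (f := fun p : X * unitI R => (p.1, clampI (2 * set_val p.2 - 1))));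
    [exact: cX|exact: cK].
pose L (p : X * unitI R) := if 2 * set_val p.2 <= 1 then F p else G p.
have cI0 (t : R) : t <= 0 -> clampI t = unitI0.
  move=> t0; apply: val_inj => /=; rewrite /clampR (@max_r _ _ 0 (1 - t)).
    by rewrite subKr max_l.
  by rewrite subr_ge0 (le_trans t0).
have cI1 (t : R) : 1 <= t -> clampI t = unitI1.
  move=> t1; apply: val_inj => /=; rewrite /clampR (@max_l _ _ 0 (1 - t)).
    by rewrite subr0 max_r.
  by rewrite subr_le0.
have c2 : continuous (fun p : X * unitI R => 2 * set_val p.2 : R).
  move=> p; apply: cvgMr.
  apply: (continuous_comp (f := snd)); first exact: cvg_snd.
  exact: initial_continuous.
exists L; split=> [p|x|x].
- case: (ltrgtP (2 * set_val p.2) (1 : R)) => p12.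
  + apply: (continuous_near_eq (cF p)).
    have := c2 p; move=> /(@cvgr_lt R _ _ _ _ _)/(_ _ p12).
    by apply: filterS => q /ltW q1; rewrite /L q1.
  + apply: (continuous_near_eq (cG p)).
    have := c2 p; move=> /(@cvgr_gt R _ _ _ _ _)/(_ _ p12).
    by apply: filterS => q q1; rewrite /L leNgt q1.
  + apply: (continuous_either (cF p) (cG p)).
    * by rewrite /L p12 lexx.
    * rewrite /L p12 lexx /F /G p12 subrr.
      by rewrite cI1 // cI0 // H1 K0.
    * by move=> q; rewrite /L; case: ifP; [left|right].
- rewrite /L /F /= mulr0 ler01 cI0 // H0.
- rewrite /L /G [set_val (x, unitI1).2](_ : _ = 1) // mulr1 ifF; last first.
    by apply/negbTE; rewrite -ltNge ltr1n.
  rewrite cI1 ?K1 //; lra.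
Qed.

Lemma homotopy_equivalent_refl (X : topologicalType) :
  homotopy_equivalent R X X.
Proof.
exists id, id; split; try by move=> ?; exact: cvg_id.
  by exists fst; split=> // p; exact: cvg_fst.
by exists fst; split=> // p; exact: cvg_fst.
Qed.

Lemma homotopy_equivalent_sym (X Y : topologicalType) :
  homotopy_equivalent R X Y -> homotopy_equivalent R Y X.
Proof. by move=> [f [g [cf cg gf fg]]]; exists g, f; split. Qed.

Lemma homotopic_whisker (X Y : topologicalType) (f : X -> Y) (g : Y -> X)
    (h : Y -> Y) :
  continuous f -> continuous g -> homotopic R h id ->
  homotopic R (g \o h \o f) (g \o f).
Proof.
move=> cf cg [H [cH H0 H1]].
exists (fun p => g (H (f p.1, p.2))); split=> [p|x|x] /=; rewrite ?H0 ?H1 //.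
apply: (continuous_comp (f := fun p : X * unitI R => H (f p.1, p.2)));
  last exact: cg.
apply: (continuous_comp (f := fun p : X * unitI R => (f p.1, p.2)));
  last exact: cH.
case: p => x t; apply: (map_pair_continuous (g := id)); first exact: cf.
exact: cvg_id.
Qed.

Lemma homotopy_equivalent_trans (X Y Z : topologicalType) :
  homotopy_equivalent R X Y -> homotopy_equivalent R Y Z ->
  homotopy_equivalent R X Z.
Proof.
move=> [f [g [cf cg gf fg]]] [f' [g' [cf' cg' gf' fg']]].
exists (f' \o f), (g \o g'); split.
- by move=> x; apply: continuous_comp; [exact: cf|exact: cf'].
- by move=> x; apply: continuous_comp; [exact: cg'|exact: cg].
- exact: homotopic_trans (homotopic_whisker cf cg gf') gf.
- exact: homotopic_trans (homotopic_whisker cg' cf' fg) fg'.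
Qed.

Definition restrict_map (X Y : Type) (A : set X) (B : set Y) (f : X -> Y)
    (fAB : forall x, A x -> B (f x)) (a : A) : B :=
  exist _ (f (set_val a)) (mem_set (fAB _ (set_valP a))).

Lemma restrict_map_continuous (X Y : topologicalType) (A : set X) (B : set Y)
    (f : X -> Y) (fAB : forall x, A x -> B (f x)) :
  continuous f -> continuous (restrict_map fAB : A -> B).
Proof.
move=> cf a; apply: set_type_continuous => /=.
apply: (continuous_comp (f := set_val)); last exact: cf.
exact: initial_continuous.
Qed.

(** With all maps given on the ambient [X] and [Y], continuity can be checked on whole cones, and
    avoiding the links becomes a pointwise condition. *)
Lemma pair_homotopy_equivalent (X Y : topologicalType) (A : set X) (B : set Y)
    (f : X -> Y) (g : Y -> X) (H : X * unitI R -> X) (K : Y * unitI R -> Y) :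
  continuous f -> continuous g -> continuous H -> continuous K ->
  (forall x, A x -> B (f x)) -> (forall y, B y -> A (g y)) ->
  (forall x t, A x -> A (H (x, t))) -> (forall y t, B y -> B (K (y, t))) ->
  (forall x, H (x, unitI0) = g (f x)) -> (forall x, H (x, unitI1) = x) ->
  (forall y, K (y, unitI0) = f (g y)) -> (forall y, K (y, unitI1) = y) ->
  homotopy_equivalent R A B.
Proof.
move=> cf cg cH cK fAB gBA HA KB H0 H1 K0 K1.
have lift (X' : topologicalType) (A' : set X') (H' : X' * unitI R -> X')
    (h : A' -> A') : continuous H' -> (forall x t, A' x -> A' (H' (x, t))) ->
    (forall a, H' (set_val a, unitI0) = set_val (h a)) ->
    (forall x, H' (x, unitI1) = x) -> homotopic R h id.
  move=> cH' HA' H0' H1'.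
  exists (fun p => exist _ (H' (set_val p.1, p.2))
    (mem_set (HA' _ p.2 (set_valP p.1)))); split=> [[a t]|a|a].
  - apply: set_type_continuous => /=.
    apply: (continuous_comp (f := fun p : A' * unitI R => (set_val p.1, p.2)));
      last exact: cH'.
    apply: (map_pair_continuous (g := id)); last exact: cvg_id.
    exact: initial_continuous.
  - by apply: val_inj => /=; rewrite -[LHS]/(H' (set_val a, unitI0)) H0'.
  - by apply: val_inj => /=; rewrite -[LHS]/(H' (set_val a, unitI1)) H1'.
exists (restrict_map fAB), (restrict_map gBA); split.
- exact: restrict_map_continuous.
- exact: restrict_map_continuous.
- by apply: (lift _ _ H).
- by apply: (lift _ _ K).
Qed.

End Homotopy.

(** * Continuous maps and homotopies on the cone over a compact space *)

Section ConeTopology.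
Context {R : realType} {X : topologicalType}.
Notation cX := (@cone R X).
Notation q := (@to_cone R X).

Lemma to_cone_eqP (p p' : X * unitI R) :
  q p = q p' <-> p = p' \/ (p.2 = unitI1 /\ p'.2 = unitI1).
Proof.
split.
  move=> /eqmodP /= /orP[/eqP|/andP[/eqP ? /eqP ?]]; by [left|right].
move=> pp'; apply/eqmodP => /=; apply/orP.
by case: pp' => [->|[-> ->]]; [left|right; rewrite eqxx].
Qed.

Lemma to_cone_surj (w : cX) : exists p, w = q p.
Proof. by exists (repr w); rewrite /to_cone reprK. Qed.

Lemma to_cone_continuous : continuous q.
Proof. exact: pi_continuous. Qed.

Lemma to_cone_image_nbhs (V : set (X * unitI R)) p : open V -> V p ->
  (forall a b, V a -> q a = q b -> V b) -> nbhs (q p) (q @` V).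
Proof.
move=> oV Vp satV; apply: open_nbhs_nbhs; split; last by exists p.
rewrite /open /= /quotient_open (_ : _ @^-1` _ = V) //.
apply/seteqP; split=> [a /= [b Vb ba]|a Va]; last by exists a.
exact: satV Vb ba.
Qed.

Hypothesis compX : compact [set: X].

(** The tube lemma with a parameter: compactness of [X] replaces neighbourhoods depending on [x] by
    a single one. *)
Lemma tube (S : topologicalType) (Q : set ((X * unitI R) * S)) (s : S) :
  (forall x : X, nbhs ((x, unitI1), s) Q) ->
  exists2 B, nbhs unitI1 B & exists2 C, nbhs s C &
    forall (x : X) t r, B t -> C r -> Q ((x, t), r).
Proof.
move=> nQ.
pose P (i : unitI R * S) x := Q ((x, i.1), i.2).
have : \forall i \near ((unitI1, s) : unitI R * S), [set: X] `<=` P i.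
  apply: ((compact_near_coveringP _).1 compX _
    (nbhs ((unitI1, s) : unitI R * S)) P (nbhs_filter _)) => x _.
  have [[A C] /= [[[A1 A2] /= [xA1 tA2] A12] sC] AC] := nQ x.
  exists (A1, A2 `*` C); first by split=> //=; exists (A2, C).
  move=> [x' [t r]] /= [A1x [A2t Cr]]; apply: (AC ((x', t), r)); split=> //=.
  exact: A12.
move=> [[B C] /= [tB sC] BC]; exists B => //; exists C => // x t r Bt Cr.
exact: (BC (t, r)).
Qed.

(** The product of a quotient map with an identity need not be a quotient map, so continuity does
    not descend formally. Here saturated product neighbourhoods exist: a tube around the whole top
    level at the cone point, and an open set avoiding the top elsewhere. *)
Lemma cone_param_continuous (S Y : topologicalType) (G : cX * S -> Y) :
  continuous (fun p : (X * unitI R) * S => G (q p.1, p.2)) -> continuous G.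
Proof.
move=> cG [w s]; have [[x t] ->] := to_cone_surj w.
move=> U; rewrite nbhsE => -[W [oW Wp] WU].
pose Q : set ((X * unitI R) * S) := [set p | W (G (q p.1, p.2))].
have nQ p : Q p -> nbhs p Q.
  by move=> Qp; apply: cG; exact: open_nbhs_nbhs.
suff [V [oV Vp satV] [C sC VC]] : exists2 V : set (X * unitI R),
    [/\ open V, V (x, t) & forall a b, V a -> q a = q b -> V b] &
    exists2 C, nbhs s C & forall p r, V p -> C r -> Q (p, r).
  exists (q @` V, C); first by split=> //=; exact: to_cone_image_nbhs.
  by move=> [_ r] /= [[p Vp' <-] Cr]; apply: WU; exact: VC.
have [t1|t1] := eqVneq t unitI1.
  have [|B B1 [C sC BC]] := @tube S Q s.
    move=> x'; apply: nQ; rewrite /Q /=.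
    by rewrite (_ : q (x', unitI1) = q (x, t)) //; apply/to_cone_eqP; right.
  exists [set p | B° p.2]; last first.
    by exists C => // -[x' t'] r /interior_subset Bt Cr; exact: BC.
  split.
  - apply: (open_comp (f := snd)); last exact: open_interior.
    by move=> ? _; exact: cvg_snd.
  - by rewrite /= t1.
  - by move=> [x1 t1'] [x2 t2] /= Bt /to_cone_eqP[[_ <-]|[/= <- ->]].
have [[A C] /= [xA sC] AC] := nQ ((x, t), s) Wp.
exists (A° `&` [set p | p.2 != unitI1]); last first.
  by exists C => // p r [/interior_subset Ap _] Cr; exact: (AC (p, r)).
split=> //.
- apply: openI; first exact: open_interior.
  have -> : [set p : X * unitI R | p.2 != unitI1] =
      (fun p : X * unitI R => set_val p.2 : R) @^-1` (~` [set 1]).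
    apply/seteqP; split=> -[x' t'] /=.
      by move=> /eqP t'1 e; apply: t'1; exact: val_inj.
    by move=> t'1; apply/eqP => e; apply: t'1; rewrite e.
  apply: open_comp; last by apply: closed_openC; exact: closed_eq.
  move=> p _; apply: (continuous_comp (f := snd)); first exact: cvg_snd.
  exact: initial_continuous.
- move=> a b [Aa a1] /to_cone_eqP[<-|[a1']] //.
  by move: a1; rewrite /= a1' eqxx.
Qed.

Lemma cone_lift (S Y : topologicalType) (Phi : (X * unitI R) * S -> Y) :
  continuous Phi ->
  (forall x x' s, Phi ((x, unitI1), s) = Phi ((x', unitI1), s)) ->
  exists2 G : cX * S -> Y, continuous G & forall p s, G (q p, s) = Phi (p, s).
Proof.
move=> cPhi topPhi.
have GE p s : Phi (repr (q p : {eq_quot (@cone_equiv R X)}), s) = Phi (p, s).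
  have /to_cone_eqP : q (repr (q p : {eq_quot (@cone_equiv R X)})) = q p.
    by rewrite /to_cone reprK.
  case=> [->//|]; case: (repr _) => x t; case: p => x' t' /= [-> ->].
  exact: topPhi.
exists (fun w => Phi (repr (w.1 : {eq_quot (@cone_equiv R X)}), w.2)).
  apply: cone_param_continuous => /=.
  by rewrite (_ : (fun p => _) = Phi) //; apply/funext => -[p s]; exact: GE.
by move=> p s; exact: GE.
Qed.

Lemma cone_lift0 (Y : topologicalType) (phi : X * unitI R -> Y) :
  continuous phi -> (forall x x', phi (x, unitI1) = phi (x', unitI1)) ->
  exists2 g : cX -> Y, continuous g & forall p, g (q p) = phi p.
Proof.
move=> cphi topphi.
have [|x x' s|G cG GE] := @cone_lift (unitI R) Y (phi \o fst).
- by move=> p; apply: continuous_comp; [exact: cvg_fst|exact: cphi].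
- exact: topphi.
exists (fun w => G (w, unitI0)) => [w|p]; last by rewrite GE.
apply: (continuous_comp (f := fun w => (w, unitI0))); last exact: cG.
move=> U [[A B] /= [wA sB] AB]; apply: filterS wA => z Az; apply: AB.
by split=> //; exact: nbhs_singleton.
Qed.

(** Compactness again: a neighbourhood of the cone point contains a full collar of the top level.
    Continuity of the homotopy inverse in the direct step depends on this. *)
Lemma near_cone_point (U : set cX) (x0 : X) : nbhs (q (x0, unitI1)) U ->
  \forall t \near (unitI1 : unitI R), forall x, U (q (x, t)).
Proof.
move=> nU.
have [|B B1 [C sC BC]] := @tube (unitI R) [set p | U (q p.1)] unitI0.
  move=> x; apply: (continuous_comp (f := fst) (g := q)).
  - exact: cvg_fst.
  - exact: to_cone_continuous.
  - rewrite /= (_ : q (x, unitI1) = q (x0, unitI1)) //.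
    by apply/to_cone_eqP; right.
apply: filterS B1 => t Bt x; apply: (BC x t unitI0) => //.
exact: nbhs_singleton.
Qed.

End ConeTopology.

Section Push.
Context {R : realType}.

(** Interpolation from [t] towards 1 with weight [a]; the clamp changes nothing for [a] in [0,1] and
    makes the map total in [a]. *)
Definition push (a : R) (t : unitI R) : unitI R :=
  clampI (set_val t + a * (1 - set_val t)).

Lemma push_continuous : continuous (fun p : R * unitI R => push p.1 p.2).
Proof.
move=> [a t]; apply: (continuous_comp
  (f := fun p : R * unitI R => set_val p.2 + p.1 * (1 - set_val p.2) : R));
  last exact: clampI_continuous.
have cv : {for (a, t), continuous (fun p : R * unitI R => set_val p.2 : R)}.
  apply: (continuous_comp (f := snd)); first exact: cvg_snd.
  exact: initial_continuous.
apply: (@continuousD _ R^o) => //; apply: (@continuousM R).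
  exact: cvg_fst.
apply: (@continuousB _ R^o); last exact: cv.
exact: cst_continuous.
Qed.

Lemma push0 t : push 0 t = t.
Proof. by rewrite /push mul0r addr0 clampI_id. Qed.

Lemma push1 t : push 1 t = unitI1.
Proof.
rewrite /push mul1r subrKC; apply: val_inj => /=.
by rewrite clampR_id // ler01 lexx.
Qed.

Lemma push_top a : push a unitI1 = unitI1.
Proof.
by rewrite /push [set_val _](_ : _ = 1) // subrr mulr0 addr0 -[RHS]clampI_id.
Qed.

End Push.

(** * Invariance under virtual equivalence *)

Section Steps.
Context {R : realType}.

(** Both homeomorphisms fix the top, so they descend to mutually inverse maps of the cone; the
    homotopies are constant, hence [fst]. *)
Lemma ambient_equiv_cone (X : topologicalType) (L L' : set (X * unitI R)) :
  compact [set: X] -> ambient_equiv [set p | p.2 = unitI1] L L' ->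
  homotopy_equivalent R (~` (@to_cone R X @` L)) (~` (@to_cone R X @` L')).
Proof.
move=> cX [H [H' [cH cH' HK H'K [HT <-]]]].
have H'T z : z.2 = unitI1 -> H' z = z by move=> /HT Hz; rewrite -{1}Hz HK.
have lift (h : X * unitI R -> X * unitI R) : continuous h ->
    (forall z, z.2 = unitI1 -> h z = z) -> exists2 g : @cone R X -> @cone R X,
    continuous g & forall p, g (to_cone p) = to_cone (h p).
  move=> ch hT; apply: (@cone_lift0 R X cX _ (fun p => to_cone (h p))).
    by move=> p; apply: continuous_comp; [exact: ch|exact: to_cone_continuous].
  by move=> x x'; rewrite !hT //; apply/to_cone_eqP; right.
have [f cf fE] := lift H cH HT; have [g cg gE] := lift H' cH' H'T.
have gf w : g (f w) = w by have [p ->] := to_cone_surj w; rewrite fE gE HK.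
have fg w : f (g w) = w by have [p ->] := to_cone_surj w; rewrite gE fE H'K.
have fstc (Y S : topologicalType) : continuous (fst : Y * S -> Y).
  by move=> ?; exact: cvg_fst.
apply: (pair_homotopy_equivalent cf cg (fstc _ _) (fstc _ _)) => //.
  move=> w nLw [_ [p Lp <-] pw]; apply: nLw; exists p => //.
  by rewrite -[w]gf -pw gE HK.
move=> w nLw [p Lp pw]; apply: nLw.
by exists (H p); [exists p|rewrite -fE pw fg].
Qed.

(** A point pushed into [L] lies on a line over the projection of [L], where [u] vanishes, so it
    never moved and was already in [L]; the cone point is excluded because [L] misses the top. Time
    runs from the full push at 0 to the identity at 1, whence the factor 1 - s. *)
Lemma push_homotopy (X : topologicalType) (u : X -> R) (L : set (X * unitI R)) :
  compact [set: X] -> continuous u -> (forall p, L p -> p.2 <> unitI1) ->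
  (forall p, L p -> u p.1 = 0) ->
  exists H : @cone R X * unitI R -> @cone R X,
  [/\ continuous H,
      forall x t, H (to_cone (x, t), unitI0) = to_cone (x, push (u x) t),
      forall w, H (w, unitI1) = w &
      forall w s, (~` (@to_cone R X @` L)) w ->
        (~` (@to_cone R X @` L)) (H (w, s))].
Proof.
move=> cX cu L1 uL.
pose Phi (p : (X * unitI R) * unitI R) : @cone R X :=
  to_cone (p.1.1, push ((1 - set_val p.2) * u p.1.1) p.1.2).
have cPhi : continuous Phi.
  move=> p; apply: (continuous_comp (g := @to_cone R X)
    (f := fun p : (X * unitI R) * unitI R =>
      (p.1.1, push ((1 - set_val p.2) * u p.1.1) p.1.2)));
    last exact: to_cone_continuous.
  have c11 : {for p, continuous (fun p : (X * unitI R) * unitI R => p.1.1)}.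
    by apply: (continuous_comp (f := fst) (g := fst)); exact: cvg_fst.
  apply: pair_continuous => //.
  apply: (continuous_comp (g := fun q : R * unitI R => push q.1 q.2)
    (f := fun p : (X * unitI R) * unitI R =>
      ((1 - set_val p.2) * u p.1.1, p.1.2))); last exact: push_continuous.
  apply: pair_continuous; last first.
    apply: (continuous_comp (f := fst) (g := snd)); first exact: cvg_fst.
    exact: cvg_snd.
  apply: (@continuousM R).
    apply: (@continuousB _ R^o); first exact: cst_continuous.
    apply: (continuous_comp (f := snd)); first exact: cvg_snd.
    exact: initial_continuous.
  apply: (continuous_comp (f := fun p : (X * unitI R) * unitI R => p.1.1)).
    exact: c11.
  exact: cu.
have [x x' s|H cH HE] := cone_lift cX cPhi.
  by rewrite /Phi /= !push_top; apply/to_cone_eqP; right.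
exists H; split=> //.
- move=> x t; rewrite HE /Phi /= [set_val _](_ : _ = 0) //.
  by rewrite subr0 mul1r.
- move=> w; have [[x t] ->] := to_cone_surj w.
  by rewrite HE /Phi /= [set_val _](_ : _ = 1) // subrr mul0r push0.
- move=> w s; have [[x t] ->] := to_cone_surj w => nL [p Lp].
  rewrite HE /Phi /= => /to_cone_eqP[pE|[/L1]//].
  apply: nL; exists p => //; move: (uL _ Lp); rewrite pE /= => ->.
  by rewrite mulr0 push0.
Qed.

(* Near p, (dg_p)^-1 o g is a 1/2-Lipschitz perturbation of the identity; by
   McShane it agrees there with a homeomorphism of the whole space. *)
Lemma inverse_function_nbhs n (W : set 'rV[R]_n) 
    (g : 'rV[R]_n -> 'rV[R]_n) p B :
  open W -> W p -> smooth_on W g -> injective ('d g p) -> nbhs p B ->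
  nbhs (g p) (g @` B).
Proof.
move=> oW Wp sg ig pB.
have cD : continuous ('d g p).
  by apply: diff_continuous; have [dg _] := sg 1; exact: dg.
have [m m0 mD] := injective_linear_bounded_below cD ig.
(* [D] inverts ['d g p] and expands norms by at most [m^-1], so an error [m / 2] in strict
   differentiability becomes the constant 1/2. *)
pose D (v : 'rV[R]_n) := v *m invmx (lin1_mx ('d g p)).
have uD : lin1_mx ('d g p) \in unitmx.
  rewrite -row_free_unit -kermx_eq0; apply/eqP/row_matrixP => i.
  rewrite row0; apply: ig; rewrite linear0 -mul_rV_lin1 -row_mul mulmx_ker.
  exact: row0.
have DK v : D ('d g p v) = v by rewrite /D -mul_rV_lin1 mulmxK.
have KD v : 'd g p (D v) = v by rewrite /D -mul_rV_lin1 mulmxKV.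
have Dlin v w : D (v - w) = D v - D w by rewrite /D mulmxBl.
have Dm v : m * `|D v| <= `|v| by rewrite -{2}(KD v).
have m2 : 0 < m / 2 by rewrite divr_gt0.
have [r r0 gr] := strict_differentiability (rV_coords n) (rV_coords n) oW Wp
  (sg 1) m2.
pose G : set ('rV[R]_n * 'rV[R]_n) :=
  [set q | ball p r q.1 /\ q.2 = D (g q.1) - q.1].
have [v vlip vG] : exists2 v : 'rV[R]_n -> 'rV[R]_n,
    forall x y, `|v x - v y| <= 2^-1 * `|x - y| & forall q, G q -> v q.1 = q.2.
  apply: (lipschitz_extension (rV_coords n)) => //.
  move=> [a a'] [b b'] [/= pa ->] [/= pb ->].
  rewrite (_ : D (g a) - a - (D (g b) - b) =
      D (g a - g b - 'd g p (a - b))); last first.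
    by rewrite !Dlin DK !opprB addrACA [RHS]addrACA [- a - _]addrC.
  have := Dm (g a - g b - 'd g p (a - b)); have := gr a b pa pb => h1 h2.
  have := le_trans h2 h1; rewrite -mulrA ler_pM2l //.
have [h [ch ch' hK h'K]] := perturbed_identity (rV_coords n) vlip.
have hE a : ball p r a -> a + v a = D (g a).
  by move=> pa; rewrite (vG (a, D (g a) - a)) ?subrKC.
pose B' := B `&` ball p r.
have pB' : nbhs (h (D (g p))) B'.
  rewrite -(hE p) ?hK; last exact: ballxx.
  by apply: filterI => //; exact: nbhsx_ballx.
have cDg : continuous D.
  apply: (@lipschitz_continuous _ _ m^-1) => x y.
  by rewrite -Dlin ler_pdivlMl.
have : nbhs (g p) ((fun w => h (D w)) @^-1` B').
  by apply: (continuous_comp (f := D) (g := h)); [exact: cDg|exact: ch'|].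
apply: filterS => w [Bw pw]; exists (h (D w)) => //.
have := hE _ pw; rewrite h'K => Dw.
by rewrite -(KD (g _)) -Dw KD.
Qed.

End Steps.

(** * Embeddings of the base manifold *)

Section DirectStep.
Context {R : realType} {n : nat}.

Lemma cylinder_interior (F : compact_manifold R n) (p : cylinder F) :
  manifold_interior (cylinder F) p -> manifold_interior F p.1 /\ p.2 <> unitI1.
Proof.
move=> [_ [d1 [d2 [ad1 ad2 ->]]] [[d1p d2p] /interior_setX[/= i1 i2]]].
split; first by exists d1.
move: i2; rewrite ad2 /= => /interior_itv01_neq1/eqP i2 p1.
by apply: i2; rewrite p1.
Qed.

(** Dimensions agree, so an injective differential is invertible and the image contains a
    neighbourhood in the model space. It is pulled back by the target chart [c'] using only
    continuity and injectivity, so [f x] may a priori lie on the boundary of [F']. *)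
Lemma immersion_nbhs (F F' : compact_manifold R n) (f : F -> F') x :
  continuous f -> immersive f -> manifold_interior F x -> nbhs (f x) (range f).
Proof.
move=> cf imf [c ac [cx ix]].
have [_ _ ci _ _] := cm_manifold F; have [_ _ ci' ch' _] := cm_manifold F'.
have [c' ac' c'x] := ch' (f x).
have [oD cc _ op] := chart_into_euclidean (ci _ ac).
have [oc' cc' ic' _] := ci' _ ac'.
have [g [W [oW Wx sg gE]] ig] := imf _ _ ac ac' x cx c'x.
pose N := (chart_dom c `&` f @^-1` chart_dom c') `&` c @^-1` W.
have cxc : {for x, continuous c} by apply: cc.
have [oc _ _ _] := ci _ ac.
have xN : nbhs x N.
  apply: filterI; first apply: filterI.
  - exact: open_nbhs_nbhs.
  - by apply: cf; exact: open_nbhs_nbhs.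
  - by apply: cxc; exact: open_nbhs_nbhs.
have := inverse_function_nbhs oW Wx sg ig (op x N (conj cx ix) xN).
rewrite gE // => nV.
have c'fx : {for f x, continuous c'}.
  move: cc'; rewrite continuous_open_subspace // => /(_ (f x)); apply.
  by rewrite inE.
have /(filterI (open_nbhs_nbhs (conj oc' c'x))) := c'fx _ nV.
apply: filterS => z [c'z [_ [y [[cy c'y] Wy] <-]]].
rewrite gE // => /ic' yz; exists y => //.
by apply: yz; rewrite inE.
Qed.

Lemma link_closed (F : compact_manifold R n) (L : set (cylinder F)) :
  is_link L -> closed (fst @` L).
Proof.
move=> [[M [j [[[cj _] _ _] <-]]] _ _]; have [hF _ _ _ _] := cm_manifold F.
apply: compact_closed => //; rewrite image_comp.
apply: continuous_compact; last exact: (@clm_compact _ _ M).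
apply: continuous_subspaceT => y.
by apply: (continuous_comp (f := j) (g := fst)); [exact: cj|exact: cvg_fst].
Qed.

(** The map back, [phi], pushes along the line by [u] and then inverts [f]; lines over points
    outside the image go to the cone point. The two composites are then exactly the pushes on the
    cones of [F] and [F'], with weights [u \o f] and [u]. *)
Lemma direct_step (V V' : link_pair R n) : directly_equivalent V V' ->
  homotopy_equivalent R (h_complement V) (h_complement V').
Proof.
move=> [f [[cf _] imf [_ injf embf]] fL].
have linkV := link_pairP V; have linkV' := link_pairP V'.
set F := base V in f cf imf injf embf fL linkV *.
set F' := base V' in f cf imf injf embf fL linkV' *.
set L := link V in fL linkV *; set L' := link V' in fL linkV' *.
have [_ Lint _] := linkV; have [_ _ L'comp] := linkV'.
pose U : set F' := (range f)°.
have Uf y : U y -> exists x, f x = y.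
  by move=> /interior_subset[x _ <-]; exists x.
have [hF' _ _ _ _] := cm_manifold F'.
have sep : uniform_separator (fst @` L') (~` U).
  have nF' := compact_normal hF' (@cm_compact _ _ F').
  apply: ((@normal_separatorP R _).1 nF').
  - exact: link_closed.
  - by apply: open_closedC; exact: open_interior.
  - apply/seteqP; split=> // _ [[p L'p <-]]; apply.
    move: L'p; rewrite -fL => -[q /Lint/cylinder_interior[qint _] <-].
    exact: immersion_nbhs.
pose u : F' -> R := Urysohn (fst @` L') (~` U).
have cu : continuous u by exact: Urysohn_continuous.
have uL p : L' p -> u p.1 = 0.
  move=> Lp; apply: (Urysohn_sub0 sep); exists p.1 => //; by exists p.
have uU y : ~ U y -> u y = 1.
  by move=> nUy; apply: (Urysohn_sub1 sep); exists y.
have L1 p : L p -> p.2 <> unitI1 by move=> /Lint/cylinder_interior[].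
have L'1 p : L' p -> p.2 <> unitI1.
  by rewrite -fL => -[q /L1 q1 <-].
have ufL p : L p -> u (f p.1) = 0.
  by move=> Lp; apply: (uL (f p.1, p.2)); rewrite -fL; exists p.
have cuf : continuous (u \o f).
  by move=> x; apply: continuous_comp; [exact: cf|exact: cu].
have [H [cH H0 H1 HL]] := push_homotopy (@cm_compact _ _ F) cuf L1 ufL.
have [K [cK K0 K1 KL]] := push_homotopy (@cm_compact _ _ F') cu L'1 uL.
have [h ch hE] : exists2 h : @cone R F -> @cone R F', continuous h &
    forall p, h (to_cone p) = to_cone (f p.1, p.2).
  apply: (@cone_lift0 R F (@cm_compact _ _ F) _
    (fun p => to_cone (f p.1, p.2))).
    move=> [x t]; apply: (continuous_comp (g := @to_cone R F')
      (f := fun p : F * unitI R => (f p.1, p.2)));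
      last exact: to_cone_continuous.
    by apply: (map_pair_continuous (g := id)); [exact: cf|exact: cvg_id].
  by move=> x x'; apply/to_cone_eqP; right.
(* The cone point of [F] has to be named by a point of [F]; one exists because [L'] meets every
   component of the cylinder over [F'] and is the image of [L]. *)
have F0 (y : F') : exists x : F, True.
  have [q Lq _] := L'comp (y, unitI0).
  by move: Lq; rewrite -fL => -[p _ _]; exists p.1.
(* The clauses overlap over points of [range f] outside [U]; there [u] is 1 and both give the cone
   point. *)
have /choice[phi phiP] (p : F' * unitI R) : exists w : @cone R F,
    (forall x, f x = p.1 -> w = to_cone (x, push (u p.1) p.2)) /\
    (~ U p.1 -> forall x, w = to_cone (x, unitI1)).
  have [[x xp]|np] := pselect (exists x, f x = p.1).
    exists (to_cone (x, push (u p.1) p.2)); split=> [x'|/uU -> x'].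
      by rewrite -xp => /injf ->.
    by rewrite push1; apply/to_cone_eqP; right.
  have [x0 _] := F0 p.1; exists (to_cone (x0, unitI1)); split=> [x xp|_ x].
    by exfalso; apply: np; exists x.
  by apply/to_cone_eqP; right.
have cpush : continuous (fun p : F' * unitI R => push (u p.1) p.2).
  move=> p; apply: (continuous_comp (g := fun q : R * unitI R => push q.1 q.2)
    (f := fun p : F' * unitI R => (u p.1, p.2))); last exact: push_continuous.
  case: p => y t; apply: (map_pair_continuous (g := id)); first exact: cu.
  exact: cvg_id.
have cphi : continuous phi.
  move=> p; have [Up|nUp] := pselect (U p.1); last first.
    have [x0 _] := F0 p.1; rewrite /continuous_at ((phiP p).2 nUp x0) => N nN.
    (* Near a point outside [U] the pushed height is close to 1, so the values lie in a collar of
       the cone point whether or not the nearby line lies over the image of [f]. *)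
    have near_top := near_cone_point (@cm_compact _ _ F) nN.
    have : nbhs p ((fun q : F' * unitI R => push (u q.1) q.2) @^-1`
        [set t | forall x, N (to_cone (x, t))]).
      by apply: cpush; rewrite uU // push1.
    apply: filterS => q Nq; rewrite /=.
    have [[x xq]|nq] := pselect (exists x, f x = q.1).
      by rewrite ((phiP q).1 x xq).
    rewrite ((phiP q).2 _ x0); last by move=> /Uf.
    exact: nbhs_singleton near_top x0.
  have [x xp] := Uf _ Up.
  move=> N; rewrite ((phiP p).1 _ xp) => nN.
  have [[A B] /= [xA tB] AB] :
    nbhs (x, push (u p.1) p.2) (@to_cone R F @^-1` N).
    exact: to_cone_continuous.
  have [A' [oA' A'x] A'A] : exists2 A', open_nbhs x A' & A' `<=` A.
    by move: xA; rewrite nbhsE => -[A' ? ?]; exists A'.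
  (* Over [U] continuity of the inverse of [f] comes from the openness of [f] onto its image. *)
  have [W oW WE] := embf _ oA'.
  have Wp : W p.1 by have [] : (range f `&` W) p.1; [rewrite -WE; exists x|].
  have n1 : nbhs p (fst @^-1` (U `&` W)).
    have cfst : continuous (fst : F' * unitI R -> F').
      by move=> ?; exact: cvg_fst.
    apply: cfst; apply: open_nbhs_nbhs; split=> //; apply: openI => //.
    exact: open_interior.
  have n2 : nbhs p ((fun p => push (u p.1) p.2) @^-1` B) by exact: cpush.
  apply: filterS (filterI n1 n2) => q [[Uq Wq] Bq]; rewrite /=.
  have [x' xq] := Uf _ Uq; rewrite ((phiP q).1 _ xq).
  apply: (AB (x', _)); split=> //=; apply: A'A.
  have : (f @` A') q.1 by rewrite WE -xq; split; [exists x'|rewrite xq].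
  by move=> [x'' A'x'']; rewrite -xq => /injf <-.
have [y y'|g cg gE] := cone_lift0 (@cm_compact _ _ F') cphi.
  have top (z : F') (x : F) : phi (z, unitI1) = to_cone (x, unitI1).
    have [Uz|nUz] := pselect (U z); last exact: (phiP (z, unitI1)).2.
    have [x' xz] := Uf _ Uz; rewrite ((phiP (z, unitI1)).1 _ xz) push_top.
    by apply/to_cone_eqP; right.
  by have [x0 _] := F0 y; rewrite !(top _ x0).
rewrite /h_complement -/L -/L'.
apply: (pair_homotopy_equivalent ch cg cH cK).
- move=> w; have [[x t] ->] := to_cone_surj w; rewrite hE => nL [p].
  rewrite -fL => -[[x' t'] Lq <-] /to_cone_eqP e.
  apply: nL; exists (x', t') => //.
  apply/to_cone_eqP; case: e => [[/injf -> ->]|]; by [left|right].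
- move=> w; have [[y t] ->] := to_cone_surj w; rewrite gE => nL [[x' t'] Lp].
  have [[x xy]|ny] := pselect (exists x, f x = y).
    rewrite ((phiP (y, t)).1 _ xy) => /to_cone_eqP[[xx tt]|[/L1]//].
    apply: nL; exists (f x', t'); first by rewrite -fL; exists (x', t').
    have := ufL _ Lp; rewrite /= xx xy tt => ->; rewrite push0.
    by rewrite -xy.
  rewrite ((phiP (y, t)).2 _ x'); last by move=> /Uf.
  by move=> /to_cone_eqP[[]|[]] => [/(L1 _ Lp)|/(L1 _ Lp)].
- by move=> w t; exact: HL.
- by move=> w t; exact: KL.
- move=> w; have [[x t] ->] := to_cone_surj w; rewrite H0 hE gE.
  by rewrite ((phiP (f x, t)).1 x erefl).
- exact: H1.
- move=> w; have [[y t] ->] := to_cone_surj w; rewrite K0 gE.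
  have [[x xy]|ny] := pselect (exists x, f x = y).
    by rewrite ((phiP (y, t)).1 _ xy) hE /= xy.
  have [x0 _] := F0 y; rewrite ((phiP (y, t)).2 _ x0); last by move=> /Uf.
  rewrite hE /= uU; last by move=> /Uf.
  by rewrite push1; apply/to_cone_eqP; right.
- exact: K1.
Qed.

End DirectStep.

Theorem theorem22 (R : realType) (n : nat) (hn : (1 <= n)%N)
    (V1 V2 : link_pair R n) :
  virtually_equivalent V1 V2 ->
  homotopy_equivalent R (h_complement V1) (h_complement V2).
Proof.
elim=> {V1 V2} [_ _ [V1 V2|F L L' hL hL'] | V | V1 V2 _ | V1 V2 V3 _ h12 _ h23].
- exact: direct_step.
- move=> /isotopic_ambient_equiv; apply: ambient_equiv_cone.
  exact: cm_compact.
- exact: homotopy_equivalent_refl.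
- exact: homotopy_equivalent_sym.
- exact: homotopy_equivalent_trans h12 h23.
Qed.
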